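(* Let $H$ be the hinge, and for $\lambda>0$ consider the activity vector $(\lambda_1,\lambda_2,\lambda_3)=(\lambda,1,\lambda)$ on $H$ (the Widom–Rowlinson model with activity $\lambda$). There exist real numbers $0<a<b<c$ and an infinite, countable, locally finite board $G$ such that $\hom(G,H)$ has a unique Gibbs measure for $(\lambda,1,\lambda)$ whenever $\lambda\in(0,a]\cup[b,c]$, and has more than one Gibbs measure for $(\lambda,1,\lambda)$ whenever $\lambda\in(a,b)\cup(c,\infty)$.
   Context: The hinge is the constraint graph with nodes $1$ (green), $2$ (yellow), $3$ (red), each node looped, and edges $\{1,2\},\{2,3\}$ (no edge between $1$ and $3$). $\hom(G,H)$ is the set of graph homomorphisms from the board $G$ (a countable locally finite loopless graph whose vertices are sites) to $H$, i.e. colorings of the sites by green, yellow, red with no green site adjacent to a red site, equipped with the product $\sigma$-algebra. For an activity vector $\mu=(\mu_1,\mu_2,\mu_3)$ with positive entries and a finite board, the $\mu$-measure gives $\varphi$ probability proportional to $\prod_v\mu_{\varphi(v)}$. A patch is a finite set $U$ of sites, $\partial U$ the set of sites outside $U$ adjacent to $U$, $U^+=U\cup\partial U$. A probability measure on $\hom(G,H)$ is a Gibbs measure for $\mu$ if for every patch $U$ and almost every $\psi$, its conditional probability that $\varphi|_U=\psi|_U$ given $\varphi|_{G\setminus U}=\psi|_{G\setminus U}$ equals the $\mu$-measure (on $\hom(U^+,H)$) conditional probability that $\varphi|_U=\psi|_U$ given $\varphi|_{\partial U}=\psi|_{\partial U}$. *)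

(* Defs.v *)
From HB Require Import structures.
From mathcomp Require Import all_boot all_order all_algebra.
From mathcomp Require Import finmap.
From mathcomp Require Import all_classical all_reals all_analysis.

Set Implicit Arguments.
Unset Strict Implicit.
Unset Printing Implicit Defensive.

Import Order.TTheory GRing.Theory Num.Theory.
Local Open Scope classical_set_scope.
Local Open Scope ring_scope.
Local Open Scope fset_scope.

(* The hinge H: nodes Green (1), Yellow (2), Red (3), all looped,      *)
(* edges {1,2}, {2,3}; no edge between 1 and 3.                        *)
Inductive color := Green | Yellow | Red.

Definition color_to_ord (c : color) : 'I_3 :=
  match c with Green => inord 0 | Yellow => inord 1 | Red => inord 2 end.
Definition ord_to_color (n : 'I_3) : option color :=
  match val n with 0 => Some Green | 1 => Some Yellow | 2 => Some Red | _ => None end.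
Lemma color_ordK : pcancel color_to_ord ord_to_color.
Proof. by case; rewrite /ord_to_color /= inordK. Qed.
HB.instance Definition _ := Finite.copy color (pcan_type color_ordK).
HB.instance Definition _ := isPointed.Build color Yellow.

Definition hinge_adj (c1 c2 : color) : bool :=
  match c1, c2 with
  | Green, Red | Red, Green => false
  | _, _ => true
  end.

(* Boards: countable (vertex set nat, hence infinite), locally finite  *)
(* (neighbourhoods are finite lists), loopless, undirected graphs.     *)
Record board := Board {
  nbrs : nat -> seq nat;
  nbrs_sym : forall u v, (v \in nbrs u) = (u \in nbrs v);
  nbrs_loopless : forall u, u \notin nbrs u }.

Definition gadj (G : board) (u v : nat) : bool := v \in nbrs G u.

Definition config := (nat -> color).

Definition is_hom (G : board) (phi : config) : Prop :=
  forall u v, gadj G u v -> hinge_adj (phi u) (phi v).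

Definition cylinders : set (set config) :=
  [set A | exists v c, A = [set phi : config | phi v = c]].

Definition Config := g_sigma_algebraType cylinders.

Definition outside_sigma (U : {fset nat}) : set (set config) :=
  <<s [set A | exists v c, v \notin U /\ A = [set phi : config | phi v = c]] >>.

Definition Uplus (G : board) (U : {fset nat}) : {fset nat} :=
  seq_fset tt (enum_fset U ++ flatten (map (nbrs G) (enum_fset U))).

Section FiniteBoard.
Variables (R : realType) (G : board) (W : {fset nat}).

Definition hom_on (xi : {ffun W -> color}) : bool :=
  [forall u : W, forall v : W, gadj G (val u) (val v) ==> hinge_adj (xi u) (xi v)].

Definition weight (mu : color -> R) (xi : {ffun W -> color}) : R :=
  if hom_on xi then \prod_(w : W) mu (xi w) else 0.

Definition mu_measure (mu : color -> R) (xi : {ffun W -> color}) : R :=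
  weight mu xi / \sum_(xi' : {ffun W -> color}) weight mu xi'.

Definition mu_prob (mu : color -> R) (E : pred {ffun W -> color}) : R :=
  \sum_(xi : {ffun W -> color} | E xi) mu_measure mu xi.
End FiniteBoard.

Definition agree_in (G : board) (U : {fset nat})
    (xi : {ffun Uplus G U -> color}) (psi : config) : bool :=
  [forall w : Uplus G U, (val w \in U) ==> (xi w == psi (val w))].
Definition agree_bd (G : board) (U : {fset nat})
    (xi : {ffun Uplus G U -> color}) (psi : config) : bool :=
  [forall w : Uplus G U, (val w \notin U) ==> (xi w == psi (val w))].

Definition spec (R : realType) (G : board) (mu : color -> R)
    (U : {fset nat}) (eta psi : config) : R :=
  @mu_prob R G (Uplus G U) mu
    (fun xi => @agree_in G U xi eta && @agree_bd G U xi psi) /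
  @mu_prob R G (Uplus G U) mu (fun xi => @agree_bd G U xi psi).

(* Gibbs measures: P is a probability measure concentrated on hom(G,H) *)
(* and, for every patch U, the conditional probability (w.r.t. the     *)
(* sigma-algebra of the sites outside U) of {phi|_U = eta} is, a.s.,   *)
(* spec ... U eta psi; written out via the defining property of        *)
(* conditional probability.                                            *)
Definition is_gibbs (R : realType) (G : board) (mu : color -> R)
    (P : probability Config R) : Prop :=
  P [set phi | is_hom G phi] = 1%E /\
  forall (U : {fset nat}) (eta : config) (B : set config),
    outside_sigma U B ->
    P (setI [set phi : config | forall v, v \in U -> phi v = eta v] B) =
    (\int[P]_(psi in B) (spec G mu U eta psi)%:E)%E.

Definition unique_gibbs (R : realType) (G : board) (mu : color -> R) : Prop :=
  (exists P : probability Config R, is_gibbs G mu P) /\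
  forall P1 P2 : probability Config R, is_gibbs G mu P1 -> is_gibbs G mu P2 ->
    forall A : set Config, measurable A -> P1 A = P2 A.

Definition multiple_gibbs (R : realType) (G : board) (mu : color -> R) : Prop :=
  exists P1 P2 : probability Config R,
    [/\ is_gibbs G mu P1, is_gibbs G mu P2 &
        exists A : set Config, measurable A /\ P1 A <> P2 A].

Definition wr_activity (R : realType) (lambda : R) (c : color) : R :=
  match c with Green => lambda | Yellow => 1 | Red => lambda end.

(* Main.v *)
Require Import Defs.
From HB Require Import structures.
From mathcomp Require Import all_boot all_order all_algebra.
From mathcomp Require Import finmap ring lra zify.
From mathcomp Require Import all_classical all_reals all_analysis.
From mathcomp Require Import measurable_realfun.
Import Order.TTheory GRing.Theory Num.Theory.
Import numFieldNormedType.Exports.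
Local Open Scope ring_scope.

Set Implicit Arguments.
Unset Strict Implicit.
Unset Printing Implicit Defensive.

(* The board is a d-ary tree whose every node carries m pendant leaves.  Summing
   out the leaves turns the activity l into l ((1 + l) / (1 + 2 l))^m at the
   nodes, a function that, for m = 12, increases, then decreases, then increases
   to infinity.  It remains to see that the Widom-Rowlinson model on the d-ary
   tree has several Gibbs measures exactly when the activity exceeds
   L_d = ((d + 1) / d)^d / (d - 1), and to choose d (d = 160) such that the graph
   of the effective activity crosses the level L_d three times.

   Let x and z be the weights of green and red relative to yellow at the root of
   a subtree; the recursion is x = L ((1 + x) / (1 + x + z))^d, and symmetrically
   for z.  A fixed point gives a Gibbs measure, namely a Markov chain on the
   tree.  Writing u = (1 + x) / (1 + z), an asymmetric fixed point forces
   L = ([d + 1] / [d])^d / (u [d - 1]) with [n] = 1 + u + ... + u^(n-1); by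
   [n + 1] [n - 1] = [n]^2 - u^(n-1) and [n]^2 >= n^2 u^(n-1) the right-hand side
   is minimal exactly at u = 1, where it equals L_d.  For L <= L_d, iterating the
   (monotone) recursion from the extreme values (L, 0) squeezes the weights
   obtained from arbitrary boundary conditions to the unique fixed point, so that
   every Gibbs measure has the same cylinder probabilities. *)

(** * Configurations *)

Section Configurations.

Lemma big_color (T : Type) (idx : T) (op : Monoid.com_law idx) (F : color -> T) :
  \big[op/idx]_(c : color) F c = op (F Green) (op (F Yellow) (F Red)).
Proof.
have -> : \big[op/idx]_(c : color) F c = \big[op/idx]_(c <- [:: Green; Yellow; Red]) F c.
  have [gy gr yr] : [/\ Green == Yellow = false, Green == Red = false & Yellow == Red = false].
    by split; apply/eqP.
  apply: perm_big; apply: uniq_perm; first exact: index_enum_uniq.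
    by rewrite /= !inE gy gr yr.
  by move=> c; rewrite mem_index_enum !inE; case: c; rewrite ?eqxx ?orbT.
by rewrite !big_cons big_nil Monoid.mulm1.
Qed.

Definition upd (xi : config) (v : nat) (c : color) : config :=
  fun u => if u == v then c else xi u.

Lemma upd_same xi v c : upd xi v c v = c.
Proof. by rewrite /upd eqxx. Qed.

Lemma upd_id xi v : upd xi v (xi v) = xi.
Proof. by apply/funext => u; rewrite /upd; case: eqP => [->|]. Qed.

Definition agree (V : pred nat) (phi psi : config) := forall v, V v -> phi v = psi v.

Definition cell (V : pred nat) (psi : config) : set config := [set phi | agree V phi psi].

Lemma eq_cell V V' psi psi' : V =1 V' -> agree V psi psi' -> cell V psi = cell V' psi'.
Proof.
move=> VV' pp; apply/seteqP; split=> phi h v vV.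
  by rewrite h ?VV' // pp ?VV'.
by rewrite h -?VV' // pp.
Qed.

Definition depends_on (T : Type) (V : pred nat) (f : config -> T) :=
  forall phi psi, agree V phi psi -> f phi = f psi.

Lemma depends_on_upd (T : Type) (V V' : pred nat) (f : config -> T) v c :
  (forall u, V u -> (u == v) || V' u) ->
  depends_on V f -> depends_on V' (fun phi => f (upd phi v c)).
Proof.
move=> VV' lf phi psi h; apply: lf => u /VV'; rewrite /upd.
by case: eqP => //= _ /h.
Qed.

Lemma measurable_color_at v c : measurable ([set phi | phi v = c] : set Config).
Proof. by apply: sub_sigma_algebra; exists v, c. Qed.

(** Split [A] by the colour of the last site: once this colour is fixed, the slice depends on one
    site fewer. A set depending on no site is empty or full. *)
Lemma depends_on_measurable_lt n (A : set Config) : depends_on (fun v => (v < n)%N) A ->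
  measurable A.
Proof.
elim: n A => [|n IH] A lA.
  case: (pselect (exists phi, A phi)) => [[phi Aphi]|nA].
    suff -> : A = setT by exact: measurableT.
    by apply/seteqP; split=> // psi _; rewrite -(lA phi).
  suff -> : A = set0 by exact: measurable0.
  by apply/seteqP; split=> // psi Apsi; case: nA; exists psi.
pose B c : set Config := ([set phi : config | phi n = c] `&` [set phi | A (upd phi n c)])%classic.
have -> : A = (\bigcup_(c in setT) B c)%classic.
  apply/seteqP; split=> [phi Aphi|phi [c _ [/= <-]]]; last by rewrite upd_id.
  by exists (phi n) => //=; split; rewrite /= ?upd_id.
apply: (@fin_bigcup_measurable _ Config); first exact: finite_finset.
move=> c _; apply: measurableI; first exact: measurable_color_at.
apply: IH; apply: depends_on_upd lA => u; rewrite ltnS leq_eqVlt; exact.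
Qed.

Lemma seq_bounded (s : seq nat) : exists n, forall v, v \in s -> (v < n)%N.
Proof.
elim: s => [|u s [n hn]]; first by exists 0%N.
exists (maxn u.+1 n) => v; rewrite inE leq_max => /orP[/eqP->|/hn->].
  by rewrite leqnn.
by rewrite orbT.
Qed.

Lemma depends_on_measurable (s : seq nat) (A : set Config) : depends_on (mem s) A ->
  measurable A.
Proof.
move=> lA; have [n hn] := seq_bounded s.
by apply: (@depends_on_measurable_lt n) => phi psi h; apply: lA => v vs; exact/h/hn.
Qed.

Lemma depends_on_measurable_fun (s : seq nat) d (T : measurableType d) (f : Config -> T) :
  depends_on (mem s) f -> measurable_fun setT f.
Proof.
move=> lf _ Y _; rewrite setTI; apply: (@depends_on_measurable s) => phi psi h.
by rewrite /preimage /= (lf phi psi).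
Qed.

Lemma depends_on_cell V psi : depends_on V (cell V psi).
Proof.
move=> phi phi' h; apply/propext; split=> hp v vV; first by rewrite -h // hp.
by rewrite h // hp.
Qed.

Lemma measurable_cell (s : seq nat) (V : pred nat) psi : (forall v, V v -> v \in s) ->
  measurable (cell V psi : set Config).
Proof.
move=> Vs; apply: (@depends_on_measurable s) => phi phi' h.
by apply: (@depends_on_cell V) => v /Vs; exact: h.
Qed.

Lemma measure_split (R : realType) (nu : {measure set Config -> \bar R}) (A : set Config) v :
  measurable A -> nu A = (\sum_(c : color) nu (A `&` [set phi | phi v = c])%classic)%E.
Proof.
move=> mA; rewrite big_color /=.
have mc c : measurable (A `&` [set phi : config | phi v = c] : set Config)%classic.
  by apply: (@measurableI _ Config) => //; exact: measurable_color_at.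
have e : A = ((A `&` [set phi : config | phi v = Green]) `|`
   ((A `&` [set phi : config | phi v = Yellow]) `|` (A `&` [set phi : config | phi v = Red])))%classic.
  rewrite -!setIUr; apply/esym/setIidl => phi _ /=.
  by case: (phi v); [left|right; left|right; right].
rewrite [in LHS]e measureU //; first 1 last.
- exact: measurableU.
- by apply/seteqP; split=> // phi [[_ /= ep] [[_]|[_]]]; rewrite /= ep.
by rewrite measureU //; apply/seteqP; split=> // phi [[_ /= ->] [_]].
Qed.

Lemma cell_upd (V V' : pred nat) v c xi : ~~ V v -> (forall u, V' u = (u == v) || V u) ->
  (cell V xi `&` [set phi | phi v = c])%classic = cell V' (upd xi v c).
Proof.
move=> vV V'E; apply/seteqP; split=> phi.
  move=> [h /= hv] u; rewrite V'E /upd; case: eqP => [->//|_ /= uV]; exact: h.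
move=> h; split=> [u uV|/=]; last by rewrite h ?V'E ?eqxx // upd_same.
rewrite h ?V'E ?uV ?orbT // /upd; case: eqP => // e.
by move: vV; rewrite -e uV.
Qed.

(** An event determined by the sites of [s] is a finite disjoint union of cells. The set [D] makes
    the induction work: it absorbs the colour of each site as that site is removed from [s]. *)
Lemma eq_measure_cells (R : realType) (nu1 nu2 : {measure set Config -> \bar R})
    (s : seq nat) (D : set Config) : uniq s -> measurable D ->
  (forall xi, nu1 (cell (mem s) xi `&` D)%classic = nu2 (cell (mem s) xi `&` D)%classic) ->
  forall A, depends_on (mem s) A -> nu1 (A `&` D)%classic = nu2 (A `&` D)%classic.
Proof.
elim: s D => [|v s IH] D /=.
  move=> _ mD h A lA.
  case: (pselect (exists phi, A phi)) => [[phi Aphi]|nA].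
    suff -> : A = cell (mem [::]) phi by exact: h.
    by apply/seteqP; split=> // psi _; rewrite -(lA phi).
  suff -> : A = set0 by rewrite set0I !measure0.
  by apply/seteqP; split=> // psi Apsi; case: nA; exists psi.
move=> /andP[vs us] mD h A lA.
have mA : measurable (A : set Config) by exact: depends_on_measurable lA.
rewrite !(@measure_split _ _ (A `&` D)%classic v); try exact: (@measurableI _ Config).
apply: eq_bigr => c _.
have -> : (A `&` D `&` [set phi | phi v = c] =
    [set phi | A (upd phi v c)] `&` (D `&` [set phi | phi v = c]))%classic.
  by apply/seteqP; split=> phi; [move=> [[Ap Dp] /= <-]|move=> [+ [Dp /= e]]];
    rewrite /= -?e upd_id.
apply: IH => //.
- by apply: (@measurableI _ Config) => //; exact: measurable_color_at.
- move=> xi; rewrite (setIC D) setIA.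
  rewrite (@cell_upd _ (mem (v :: s))) //.
- by apply: depends_on_upd lA => u /=; rewrite inE.
Qed.

(** * Finite sums over the colours of selected sites *)

Section IteratedSums.
Variable R : realType.
Implicit Types (s : seq nat) (F G : config -> R) (psi : config).

(** Summation over the recolourings of the sites in [s], kept on full configurations so that one
    does not have to pass between finite functions on varying domains. *)
Fixpoint sumon s F psi : R :=
  if s is v :: s' then \sum_(c : color) sumon s' F (upd psi v c) else F psi.

Lemma eq_sumon s F G psi :
  (forall xi, (forall v, v \notin s -> xi v = psi v) -> F xi = G xi) ->
  sumon s F psi = sumon s G psi.
Proof.
elim: s psi => [|v s IH] psi /= FG; first exact: FG.
apply: eq_bigr => c _; apply: IH => xi h; apply: FG => u; rewrite inE negb_or => /andP[uv us].
by rewrite h // /upd (negPf uv).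
Qed.

Lemma sumonZ s F (k : R) psi : sumon s (fun xi => k * F xi) psi = k * sumon s F psi.
Proof.
elim: s psi => [|v s IH] psi //=.
by rewrite mulr_sumr; apply: eq_bigr => c _; rewrite IH.
Qed.

Lemma sumon_ge0 s F psi : (forall xi, 0 <= F xi) -> 0 <= sumon s F psi.
Proof. by move=> F0; elim: s psi => [|v s IH] psi //=; exact: sumr_ge0. Qed.

Lemma sumon_eq0 s F psi : (forall xi, 0 <= F xi) -> sumon s F psi = 0 ->
  forall xi, (forall v, v \notin s -> xi v = psi v) -> F xi = 0.
Proof.
move=> F0; elim: s psi => [|v s IH] psi /= h xi hxi.
  by rewrite -h; congr F; apply/funext => v; exact: hxi.
move/eqP: h; rewrite psumr_eq0 => [/allP h|c _]; last exact: sumon_ge0.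
apply: (IH (upd psi v (xi v))).
  by apply/eqP; exact: (implyP (h (xi v) (mem_index_enum _))).
by move=> u us; rewrite /upd; case: eqP => [->//|/eqP uv]; rewrite hxi // inE negb_or uv.
Qed.

Lemma prob_cell_sumon (P : probability Config R) (V : seq nat) s psi :
  uniq s -> (forall v, v \in s -> v \notin V) ->
  P (cell (mem V) psi) = (sumon s (fun xi => fine (P (cell (mem (s ++ V)) xi))) psi)%:E.
Proof.
elim: s V psi => [|v s IH] V psi /=.
  by move=> _ _; rewrite fineK // fin_num_measure //; exact: (@measurable_cell V).
move=> /andP[vs us] sV.
have vV : v \notin V by apply: sV; rewrite mem_head.
rewrite (@measure_split _ _ _ v); last exact: (@measurable_cell V).
rewrite -sumEFin; apply: eq_bigr => c _.
rewrite (@cell_upd _ (mem (v :: V))) //.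
apply: etrans (IH (v :: V) _ us _) _; last first.
  congr (_%:E); apply: eq_sumon => xi _; congr (fine (P _)).
  by apply: eq_cell => // u; rewrite /= !(mem_cat, inE) orbCA.
move=> u us'; rewrite inE negb_or sV ?inE ?us' ?orbT // andbT.
by apply/eqP => e; move: vs; rewrite -e us'.
Qed.

Definition restr (W : {fset nat}) (xi : config) : {ffun W -> color} := [ffun w => xi (val w)].

(** The bridge between the finite boards in the definition of [spec] and iterated sums over
    configurations. *)
Lemma sum_restr_sumon (W : {fset nat}) s psi (F : {ffun W -> color} -> R) :
  uniq s -> {subset s <= W} ->
  \sum_(xi : {ffun W -> color} | [forall w : W, (val w \notin s) ==> (xi w == psi (val w))])
    F xi = sumon s (F \o @restr W) psi.
Proof.
elim: s psi => [|v s IH] psi /=.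
  move=> _ _; rewrite (big_pred1 (restr W psi)) // => xi /=.
  apply/forallP/eqP => [h|-> w]; last by rewrite ffunE.
  by apply/ffunP => w; rewrite ffunE; exact/eqP.
move=> /andP[vs us] sW.
have vW : v \in W by apply: sW; rewrite mem_head.
rewrite (partition_big (fun xi : {ffun W -> color} => xi [` vW]%fset) predT) //=.
apply: eq_bigr => c _; rewrite -IH //; last by move=> u us'; apply: sW; rewrite inE us' orbT.
apply: eq_bigl => xi; apply/andP/forallP => [[/forallP h /eqP e] w|h].
  apply/implyP => ws; rewrite /upd; case: (eqVneq (val w) v) => [wv|wv].
    by rewrite -e; apply/eqP; congr (xi _); apply: val_inj.
  by apply: (implyP (h w)); rewrite inE negb_or wv.
split.
  apply/forallP => w; apply/implyP; rewrite inE negb_or => /andP[wv ws].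
  by have := implyP (h w) ws; rewrite /upd (negPf wv).
by have := implyP (h [` vW]%fset) vs; rewrite /upd /= eqxx.
Qed.
End IteratedSums.
End Configurations.

(** * Specifications and Gibbs measures *)

Section Density.
Context d (T : measurableType d) (R : realType).
Variables (mu : {measure set T -> \bar R}) (f : T -> \bar R).
Hypotheses (mf : measurable_fun setT f) (f0 : forall x, (0 <= f x)%E).

Definition density of measurable_fun setT f & (forall x, (0 <= f x)%E) :=
  fun B : set T => (\int[mu]_(x in B) f x)%E.

Local Notation nu := (density mf f0).

Let density0 : nu set0 = 0%E.
Proof. by rewrite /density integral_set0. Qed.

Let density_ge0 B : (0 <= nu B)%E.
Proof. by apply: integral_ge0 => x _. Qed.

Let density_sigma_additive : semi_sigma_additive nu.
Proof.
move=> /= F mF tF mUF; apply: cvg_toP.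
  apply: ereal_nondecreasing_is_cvgn => m n mn.
  by apply: lee_sum_nneg_natr => // k _ _; exact: density_ge0.
rewrite /density ge0_integral_bigcup //=.
exact: measurable_funTS.
Qed.

HB.instance Definition _ := isMeasure.Build _ _ _ nu
  density0 density_ge0 density_sigma_additive.
End Density.

(** * Conditional probabilities in a patch *)

Section Specification.
Variables (R : realType) (G : board) (mu : color -> R).
Hypothesis mu_gt0 : forall c, 0 < mu c.
Implicit Types (U : {fset nat}) (eta psi xi : config).

Lemma mem_Uplus U u : (u \in Uplus G U) = (u \in U) || has (fun v => gadj G v u) (enum_fset U).
Proof.
rewrite /Uplus seq_fsetE mem_cat; congr (_ || _).
apply/flatten_mapP/hasP => [[v vU uv]|[v vU uv]]; by exists v.
Qed.

Lemma sub_Uplus U : {subset enum_fset U <= Uplus G U}.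
Proof. by move=> u uU; rewrite mem_Uplus; apply/orP; left. Qed.

Definition glue U eta psi : config := fun v => if v \in U then eta v else psi v.

Definition weight_at U xi : R := weight G mu (restr (Uplus G U) xi).

Lemma weight_ge0 (W : {fset nat}) (xi : {ffun W -> color}) : 0 <= weight G mu xi.
Proof. by rewrite /weight; case: ifP => // _; apply: prodr_ge0 => w _; exact: ltW. Qed.

Lemma weight_atE U xi : weight_at U xi =
  (hom_on G (restr (Uplus G U) xi))%:R * \prod_(w : Uplus G U) mu (xi (val w)).
Proof.
rewrite /weight_at /weight; case: ifP => _; rewrite ?mul0r // mul1r.
by apply: eq_bigr => w _; rewrite ffunE.
Qed.

Lemma partition_function_gt0 (W : {fset nat}) :
  0 < \sum_(xi : {ffun W -> color}) weight G mu xi.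
Proof.
rewrite (bigD1 [ffun => Yellow]) //= ltr_wpDr //.
  by apply: sumr_ge0 => xi _; exact: weight_ge0.
rewrite /weight ifT; first by apply: prodr_gt0.
by apply/forallP => u; apply/forallP => v; rewrite !ffunE /= implybT.
Qed.

(** The partition function of the board [Uplus G U] cancels between numerator and denominator. *)
Lemma specE U eta psi :
  spec G mu U eta psi = weight_at U (glue U eta psi) / sumon (enum_fset U) (weight_at U) psi.
Proof.
rewrite /spec /mu_prob /mu_measure -!mulr_suml.
rewrite -mulf_div divff ?mulr1; last by rewrite invr_neq0 // gt_eqF // partition_function_gt0.
congr (_ / _).
  rewrite (big_pred1 (restr (Uplus G U) (glue U eta psi))) // => xi /=.
  apply/andP/eqP => [[/forallP hi /forallP hb]|->].
    apply/ffunP => w; rewrite ffunE /glue.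
    case: ifPn => wU; first by apply/eqP/(implyP (hi w)).
    exact/eqP/(implyP (hb w)).
  split; apply/forallP => w; apply/implyP => wU; rewrite ffunE /glue.
    by rewrite wU.
  by rewrite (negPf wU).
by rewrite -(sum_restr_sumon psi (weight G mu (W := Uplus G U)) (fset_uniq U) (@sub_Uplus U)).
Qed.

Lemma spec_ge0 U eta psi : 0 <= spec G mu U eta psi.
Proof.
rewrite specE divr_ge0 //; first exact: weight_ge0.
by apply: sumon_ge0 => xi; exact: weight_ge0.
Qed.

(** A function proportional to the weight inside the patch, with a factor fixed by the outside, is
    determined by its sum over the patch: normalising it gives the specification. *)
Lemma spec_prop (F : config -> R) (C : R) U psi :
  (forall eta, F (glue U eta psi) = C * weight_at U (glue U eta psi)) ->
  forall eta, F (glue U eta psi) = spec G mu U eta psi * sumon (enum_fset U) F psi.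
Proof.
move=> FC eta.
have gl xi : (forall v, v \notin enum_fset U -> xi v = psi v) -> xi = glue U xi psi.
  by move=> h; apply/funext => v; rewrite /glue; case: ifPn => // vU; exact: h.
have -> : sumon (enum_fset U) F psi = C * sumon (enum_fset U) (weight_at U) psi.
  by rewrite -sumonZ; apply: eq_sumon => xi /gl ->; exact: FC.
rewrite FC specE.
have [s0|s0] := eqVneq (sumon (enum_fset U) (weight_at U) psi) 0; last first.
  by rewrite mulrCA divfK.
(* If [psi] has no admissible extension into the patch, the denominator is 0, but then all the
   nonnegative weights vanish too and both sides are 0. *)
rewrite s0 (@sumon_eq0 _ _ _ _ _ s0) ?mulr0 ?mul0r //.
  by move=> xi; exact: weight_ge0.
by move=> v vU; rewrite /glue; case: ifPn => // h; move: vU; rewrite h.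
Qed.

Lemma spec_depends_on U eta :
  depends_on (fun v => (v \in Uplus G U) && (v \notin U)) (spec G mu U eta).
Proof.
move=> phi psi h; rewrite /spec /mu_prob.
have e (xi : {ffun Uplus G U -> color}) : @agree_bd G U xi phi = @agree_bd G U xi psi.
  apply: eq_forallb => w; case wU : (val w \in U) => //=.
  by rewrite h // wU andbT; exact: valP.
by congr (_ / _); apply: eq_bigl => xi; rewrite e.
Qed.

Lemma spec_measurable U eta : measurable_fun setT (spec G mu U eta : Config -> R).
Proof.
apply: (@depends_on_measurable_fun (enum_fset (Uplus G U))) => phi psi h.
by apply: spec_depends_on => v /andP[vU _]; exact: h.
Qed.

(** Both sides of the Gibbs equation are finite measures in [B], so it suffices to compare them on
    events determined by finitely many sites outside [U], hence on cells. There [q] is proportional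
    to the patch weight and [spec_prop] applies. *)
Lemma gibbs_of_cylinders (P : probability Config R) (q : nat -> config -> R) :
  P [set phi : config | is_hom G phi]%classic = 1%E ->
  (forall n xi, P (cell (fun v => (v < n)%N) xi) = (q n xi)%:E) ->
  (forall U, exists n0, forall n, (n0 <= n)%N -> exists C : config -> R,
    forall eta psi, q n (glue U eta psi) = C psi * weight_at U (glue U eta psi)) ->
  is_gibbs G mu P.
Proof.
move=> P1 Pq qW; split=> // U eta B oB.
have mE : measurable (cell (mem U) eta : set Config).
  exact: (@measurable_cell (enum_fset U)).
have ms : measurable_fun setT (fun psi : Config => (spec G mu U eta psi)%:E).
  by apply/measurable_EFinP; exact: spec_measurable.
have s0 psi : (0 <= (spec G mu U eta psi)%:E)%E by rewrite lee_fin spec_ge0.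
pose m1 := mrestr P mE; pose m2 := density P ms s0.
rewrite setIC; change (m1 B = m2 B).
(* A family closed under intersection that generates the events outside [U]. *)
pose GG : set (set Config) := fun A => exists s : seq nat,
  (forall v, v \in s -> v \notin U) /\ depends_on (mem s) A.
have GB : (<<s GG >>)%classic B.
  apply: (smallest_sub (smallest_sigma_algebra _ _) _ oB) => A [v [c [vU ->]]].
  apply: sub_sigma_algebra; exists [:: v]; split=> [u|phi psi h].
    by rewrite inE => /eqP ->.
  by rewrite /= h //= mem_head.
apply: (@g_sigma_algebra_measure_unique _ R Config GG _ (fun=> setT)) GB => //=.
- by move=> A [s [_ sA]]; exact: depends_on_measurable sA.
- by move=> _; exists [::].
- by rewrite bigcup_const //; exists 0%N.
- move=> A A' [s [sU sA]] [s' [sU' sA']]; exists (s ++ s'); split.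
    by move=> v; rewrite mem_cat => /orP[/sU|/sU'].
  move=> phi psi h; congr (_ /\ _).
    by apply: sA => v vs; apply: h; have : v \in s := vs; rewrite /= mem_cat => ->.
  by apply: sA' => v vs; apply: h; have : v \in s' := vs; rewrite /= mem_cat orbC => ->.
- move=> A [s [sU sA]].
  have [n1 hn1] := seq_bounded s.
  have [n2 hn2] := seq_bounded (enum_fset (Uplus G U)).
  have [n0 hn0] := qW U.
  (* The window [0, n) contains the sites of the event and all of [Uplus G U]. *)
  pose n := maxn n0 (maxn n1 n2).
  have [C hC] := hn0 n (leq_maxl _ _).
  pose s' := [seq v <- iota 0 n | v \notin U].
  have us' : uniq s' by rewrite filter_uniq // iota_uniq.
  have s'E v : (v \in s') = (v < n)%N && (v \notin U).
    by rewrite mem_filter mem_iota andbC.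
  have UN v : v \in U -> (v < n)%N.
    by move=> vU; rewrite !leq_max (hn2 v) ?orbT //; exact: sub_Uplus.
  have s'A : depends_on (mem s') A.
    move=> phi psi h; apply: sA => v vs; apply: h; rewrite /= s'E sU // andbT.
    by rewrite !leq_max hn1 // orbT.
  have := @eq_measure_cells R m1 m2 s' setT us' measurableT _ A s'A.
  rewrite !setIT; apply => xi; rewrite !setIT.
  have eP : P (cell (mem s') xi) = (sumon (enum_fset U) (q n) xi)%:E.
    rewrite (@prob_cell_sumon _ _ _ (enum_fset U)) ?fset_uniq //; last first.
      by move=> v vU; rewrite s'E negb_and vU orbT.
    congr (_%:E); apply: eq_sumon => phi _.
    rewrite (_ : cell _ _ = cell (fun v => (v < n)%N) phi) ?Pq //.
    apply: eq_cell => // v /=; rewrite mem_cat s'E.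
    by case vU : (v \in U) => /=; [rewrite UN|rewrite andbT].
  rewrite /m1 /= /mrestr.
  have -> : (cell (mem s') xi `&` cell (mem U) eta = cell (fun v => (v < n)%N) (glue U eta xi))%classic.
    apply/seteqP; split=> phi.
      move=> [h1 h2] v vn; rewrite /glue; case: ifPn => vU; first exact: h2.
      by apply: h1; rewrite /= s'E vn.
    move=> h; split=> v /=.
      by rewrite s'E => /andP[vn vU]; rewrite h // /glue (negPf vU).
    by move=> vU; rewrite h ?UN // /glue vU.
  rewrite Pq (@spec_prop (q n) (C xi)) //.
  rewrite /density.
  (* The specification only reads the boundary of [U], which lies in [s'], so the integrand is
     constant on the cell. *)
  rewrite (@eq_integral _ _ _ P _ (cst (spec G mu U eta xi)%:E)).
    rewrite integral_cst; first by rewrite EFinM; congr (_ * _)%E; exact: esym eP.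
    exact: (@measurable_cell s').
  move=> psi; rewrite inE => h; congr (_%:E); apply: spec_depends_on => v /andP[vU nU].
  by apply: h; rewrite /= s'E nU andbT !leq_max hn2 ?orbT.
- by move=> _; rewrite /m1 /= /mrestr setTI ltey_eq fin_num_measure.
Qed.
End Specification.

(** * Measures with prescribed cylinder probabilities *)

Section UnitInterval.
Variable R : realType.

Definition unit_itv : set (measurableTypeR R) := `[0, 1[%classic.

Lemma measurable_unit_itv : measurable unit_itv.
Proof. exact: measurable_itv. Qed.

Let lambda : {measure set (measurableTypeR R) -> \bar R} := lebesgue_measure.

Definition unit_measure : set (measurableTypeR R) -> \bar R := mrestr lambda measurable_unit_itv.

HB.instance Definition _ := Measure.copy unit_measure (mrestr lambda measurable_unit_itv).

Let unit_measure_setT : unit_measure setT = 1%E.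
Proof.
rewrite /unit_measure /= /mrestr setTI /lambda lebesgue_measure_itv /= lte_fin ltr01.
by rewrite sube0.
Qed.

HB.instance Definition _ := Measure_isProbability.Build _ _ _ unit_measure unit_measure_setT.
End UnitInterval.

(* A consistent family [q] of cylinder probabilities splits [0, 1[ into nested
   intervals, one for each cylinder; the map sending a point to the
   configuration whose intervals contain it pushes Lebesgue measure forward to
   the desired measure. *)
Section CylinderMeasure.
Variables (R : realType) (q : nat -> config -> R).
Hypothesis q0 : forall xi, q 0 xi = 1.
Hypothesis q_ge0 : forall n xi, 0 <= q n xi.
Hypothesis q_depends_on : forall n, depends_on (fun v => (v < n)%N) (q n).
Hypothesis q_sum : forall n xi, \sum_(c : color) q n.+1 (upd xi n c) = q n xi.

Let q3 n xi : q n.+1 (upd xi n Green) + (q n.+1 (upd xi n Yellow) +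
  q n.+1 (upd xi n Red)) = q n xi.
Proof. by rewrite -(q_sum n xi) big_color. Qed.

(** The interval of a cell is cut from left to right into green, yellow and red parts; this is how
    far the left endpoint moves when site [n] receives its colour. *)
Definition cell_offset n (xi : config) : R :=
  match xi n with
  | Green => 0
  | Yellow => q n.+1 (upd xi n Green)
  | Red => q n.+1 (upd xi n Green) + q n.+1 (upd xi n Yellow)
  end.

Definition cell_left n xi : R := \sum_(k < n) cell_offset k xi.

Definition next_color (t : R) n xi : color :=
  if t < cell_left n xi + q n.+1 (upd xi n Green) then Green
  else if t < cell_left n xi + q n.+1 (upd xi n Green) + q n.+1 (upd xi n Yellow)
  then Yellow else Red.

Fixpoint config_prefix (t : R) n : config :=
  if n is n'.+1 then upd (config_prefix t n') n' (next_color t n' (config_prefix t n'))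
  else fun=> Yellow.

Definition config_of (t : R) : config := fun v => config_prefix t v.+1 v.

Lemma config_prefix_agree t n : agree (fun v => (v < n)%N) (config_prefix t n) (config_of t).
Proof.
elim: n => [|n IH] v //; rewrite ltnS leq_eqVlt => /orP[/eqP->|vn].
  by rewrite /config_of.
by rewrite -IH //= /upd ltn_eqF.
Qed.

Lemma config_ofE t n : config_of t n = next_color t n (config_prefix t n).
Proof. by rewrite /config_of /= upd_same. Qed.

Lemma cell_offset_depends_on n : depends_on (fun v => (v < n.+1)%N) (cell_offset n).
Proof.
move=> phi psi h; rewrite /cell_offset h //.
have e c : q n.+1 (upd phi n c) = q n.+1 (upd psi n c).
  by apply: q_depends_on => v vn; rewrite /upd; case: eqP => // _; exact: h.
by case: (psi n); rewrite ?e.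
Qed.

Lemma cell_left_depends_on n : depends_on (fun v => (v < n)%N) (cell_left n).
Proof.
move=> phi psi h; apply: eq_bigr => k _; apply: cell_offset_depends_on => v vk.
by apply: h; exact: leq_trans vk (ltn_ord k).
Qed.

Lemma cell_left_ge0 n xi : 0 <= cell_left n xi.
Proof.
apply: sumr_ge0 => k _; rewrite /cell_offset; case: (xi k) => //.
by rewrite addr_ge0.
Qed.

Lemma cell_right_le1 n xi : cell_left n xi + q n xi <= 1.
Proof.
elim: n => [|n IH]; first by rewrite /cell_left big_ord0 q0 add0r.
apply: le_trans IH; rewrite /cell_left big_ord_recr /= -addrA lerD2l.
have := q3 n xi; have := q_ge0 n.+1.
rewrite /cell_offset => h; have e := upd_id xi n.
have gG := h (upd xi n Green); have gY := h (upd xi n Yellow); have gR := h (upd xi n Red).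
by case: (xi n) e => /(congr1 (q n.+1)) e; lra.
Qed.

(** By induction: the three parts tile the interval of the smaller cell, and [next_color] selects
    the part that contains [t]. *)
Lemma config_of_cell t n xi : 0 <= t < 1 ->
  agree (fun v => (v < n)%N) (config_of t) xi <->
  cell_left n xi <= t < cell_left n xi + q n xi.
Proof.
move=> t01; elim: n xi => [|n IH] xi.
  by rewrite /cell_left big_ord0 q0 add0r.
have pre : agree (fun v => (v < n)%N) (config_of t) xi ->
    next_color t n (config_prefix t n) = next_color t n xi.
  move=> h; have hp : agree (fun v => (v < n)%N) (config_prefix t n) xi.
    by move=> v vn; rewrite config_prefix_agree // h.
  rewrite /next_color (cell_left_depends_on hp).
  have e c : q n.+1 (upd (config_prefix t n) n c) = q n.+1 (upd xi n c).
    apply: q_depends_on => v; rewrite ltnS leq_eqVlt /upd; case: eqP => //= _ vn.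
    exact: hp.
  by rewrite !e.
have -> : agree (fun v => (v < n.+1)%N) (config_of t) xi <->
    agree (fun v => (v < n)%N) (config_of t) xi /\ next_color t n xi = xi n.
  split=> [h|[h e] v].
    have h' : agree (fun v => (v < n)%N) (config_of t) xi by move=> v vn; apply: h; exact: ltnW.
    by split=> //; rewrite -pre // -config_ofE h.
  rewrite ltnS leq_eqVlt => /orP[/eqP->|]; last exact: h.
  by rewrite config_ofE pre.
rewrite IH /cell_left big_ord_recr /= -/(cell_left n xi).
have := q3 n xi; rewrite /next_color /cell_offset.
have gG := q_ge0 n.+1 (upd xi n Green); have gY := q_ge0 n.+1 (upd xi n Yellow).
have gR := q_ge0 n.+1 (upd xi n Red).
have e := upd_id xi n; case: (xi n) e => /(congr1 (q n.+1));
  move: (cell_left n xi) (q n xi) (q n.+1 xi) gG gY gR => l s p;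
  set a := q _ _; set b := q _ _; set c := q _ _ => gG gY gR ep es;
  case: (ltP t (l + a)) => h1; try (case: (ltP t (l + a + b)) => h2);
  (split => [[/andP[h3 h4] h5]|/andP[h3 h4]]);
  first [by []|by apply/andP; split; lra|by exfalso; lra
    |by split=> //; apply/andP; split; lra].
Qed.

Lemma measurable_config_of_cell n xi :
  measurable (@unit_itv R `&` [set t | agree (fun v => (v < n)%N) (config_of t) xi])%classic.
Proof.
rewrite (_ : (_ `&` _)%classic =
  (@unit_itv R `&` `[cell_left n xi, (cell_left n xi + q n xi)[)%classic).
  by apply: measurableI => //; exact: measurable_itv.
apply/seteqP; split=> t /= [t01 h]; split=> //; move: t01 h; rewrite /unit_itv /= !in_itv /= => t01.
  by move=> /(config_of_cell _ _ t01).
by move=> /(config_of_cell _ _ t01).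
Qed.

(** Induction on the number [j] of sites still free: either split the cell by the colour of site
    [n], or, with no site left, use that [A] is constant on the cell. *)
Lemma measurable_config_of_prefix n j (A : set config) xi :
  depends_on (fun v => (v < n + j)%N) A ->
  measurable (@unit_itv R `&` [set t | agree (fun v => (v < n)%N) (config_of t) xi /\
     A (config_of t)])%classic.
Proof.
elim: j n xi => [|j IH] n xi lA.
  rewrite addn0 in lA; case: (pselect (A xi)) => Axi.
    rewrite (_ : [set t | _]%classic = [set t | agree (fun v => (v < n)%N) (config_of t) xi]%classic).
      exact: measurable_config_of_cell.
    by apply/seteqP; split=> t /= => [[]//|h]; split=> //; rewrite (lA _ _ h).
  rewrite (_ : (_ `&` _)%classic = set0) //.
  by apply/seteqP; split=> // t [_ [h]]; rewrite (lA _ _ h).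
rewrite (_ : (_ `&` _)%classic = (\bigcup_(c in [set: color]) (@unit_itv R `&`
    [set t | agree (fun v => (v < n.+1)%N) (config_of t) (upd xi n c) /\ A (config_of t)]))%classic).
  apply: fin_bigcup_measurable => [|c _]; first exact: finite_finset.
  by apply: IH; rewrite addSnnS.
apply/seteqP; split=> t.
  move=> [t01 [h At]]; exists (config_of t n) => //; split=> //; split=> // v.
  by rewrite ltnS leq_eqVlt /upd; case: eqP => [->//|_] /= /h.
move=> [c _ [t01 [h At]]]; split=> //; split=> // v vn.
by rewrite h 1?ltnW // /upd ltn_eqF.
Qed.

(** The constant value outside [0, 1) makes the map total; [unit_measure] gives no mass to that
    region. *)
Definition unit_config (t : R) : config :=
  if (0 <= t < 1) then config_of t else fun=> Yellow.

Lemma measurable_unit_config : measurable_fun setT (unit_config : measurableTypeR R -> Config).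
Proof.
apply: (@measurability _ _ _ Config setT unit_config cylinders) => //.
move=> _ [A [v [c ->]] <-]; rewrite setTI.
rewrite (_ : (_ @^-1` _)%classic = ((@unit_itv R `&` [set t | agree (fun v => (v < 0)%N) (config_of t)
   (fun=> Yellow) /\ config_of t v = c]) `|` (~` @unit_itv R `&` [set _ | Yellow = c]))%classic).
  apply: measurableU.
    apply: (@measurable_config_of_prefix 0 v.+1 [set phi | phi v = c]%classic) => phi psi h.
    by rewrite /= h.
  apply: measurableI; first by apply: measurableC; exact: measurable_unit_itv.
  case: (pselect (Yellow = c)) => e.
    by rewrite (_ : [set _ | _]%classic = setT) //; apply/seteqP; split.
  by rewrite (_ : [set _ | _]%classic = set0) //; apply/seteqP; split.
apply/seteqP; split=> t; rewrite /unit_itv /unit_config /preimage /= in_itv /=.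
  by case: ifP => t01 e; [left|right].
by case: ifP => t01 [[] //|[]//] _ [].
Qed.

Theorem cylinder_measure : exists P : probability Config R,
  forall n xi, P (cell (fun v => (v < n)%N) xi) = (q n xi)%:E.
Proof.
pose X : {mfun (measurableTypeR R) >-> Config} := mfun_Sub (mem_set measurable_unit_config).
exists (distribution (@unit_measure R : probability _ _) X) => n xi.
rewrite /distribution /pushforward /= /unit_measure /= /mrestr.
rewrite (_ : (_ `&` _)%classic = `[cell_left n xi, (cell_left n xi + q n xi)[%classic).
  rewrite lebesgue_measure_itv /= lte_fin ltrDl.
  have := q_ge0 n xi; rewrite le_eqVlt => /orP[/eqP <-|->]; first by rewrite ltxx.
  by rewrite -EFinD addrAC subrr add0r.
have l0 := cell_left_ge0 n xi; have l1 := cell_right_le1 n xi.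
apply/seteqP; split=> t; rewrite /unit_itv /preimage /= /unit_config !in_itv /=.
  by move=> [h t01]; move: h; rewrite t01 => /(config_of_cell _ _ t01).
move=> h; have t01 : 0 <= t < 1 by move: h => /andP[? ?]; apply/andP; split; lra.
by split=> //; rewrite t01; exact/config_of_cell.
Qed.
End CylinderMeasure.

(** * Markov chains on trees *)

Lemma hinge_adjC c c' : hinge_adj c c' = hinge_adj c' c.
Proof. by case: c; case: c'. Qed.

Lemma prodr_natb (R : comPzRingType) (I : finType) (P : pred I) (b : I -> bool) :
  \prod_(i | P i) ((b i)%:R : R) = [forall (i | P i), b i]%:R.
Proof.
case: (boolP [forall (i | P i), b i]) => [/forall_inP h|].
  by rewrite big1 // => i Pi; rewrite h.
by rewrite negb_forall_in => /exists_inP[i Pi nb]; rewrite (bigD1 i) //= (negPf nb) mul0r.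
Qed.

Lemma prodr_seq_natb (R : comPzRingType) (I : Type) (s : seq I) (P b : pred I) :
  \prod_(i <- s | P i) ((b i)%:R : R) = (all (fun i => P i ==> b i) s)%:R.
Proof.
elim: s => [|i s IH]; first by rewrite big_nil.
by rewrite big_cons IH /=; case: (P i); case: (b i) => //=; rewrite ?mul1r ?mul0r.
Qed.

Lemma prod_fset_ord (R : comPzRingType) (W U : {fset nat}) n (F : nat -> R) :
  {subset U <= W} -> (forall v, v \in U -> (v < n)%N) ->
  \prod_(v : W | val v \in U) F (val v) = \prod_(v < n | val v \in U) F v.
Proof.
move=> UW Un; rewrite -(big_seq_fsetE _ W (fun v => v \in U) F).
rewrite -(big_mkord (fun v => v \in U) F) -big_filter -[RHS]big_filter.
apply: perm_big; apply: uniq_perm; rewrite ?filter_uniq ?iota_uniq ?fset_uniq // => v.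
by rewrite !mem_filter mem_index_iota; case vU : (v \in U) => //=; rewrite UW // Un.
Qed.

Lemma mem_iota0 n u : mem (iota 0 n) u = (u < n)%N.
Proof. exact: (mem_iota 0 n u). Qed.

(** The root is 0 and parents have smaller numbers than their children, so every initial segment of
    the sites is a subtree and colours can be drawn in numerical order. *)
Record tree := Tree {
  par : nat -> nat;
  ch : nat -> seq nat;
  par_lt : forall v, (0 < v)%N -> (par v < v)%N;
  mem_ch : forall u v, (u \in ch v) = (0 < u)%N && (par u == v);
  ch_uniq : forall v, uniq (ch v) }.

Section Tree.
Variable t : tree.

Definition tree_nbrs v : seq nat := (if v is _.+1 then [:: par t v] else [::]) ++ ch t v.

Lemma mem_tree_nbrs u v : (v \in tree_nbrs u) =
  ((0 < u)%N && (par t u == v)) || ((0 < v)%N && (par t v == u)).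
Proof.
rewrite /tree_nbrs mem_cat mem_ch; congr (_ || _).
by case: u => [|u] //=; rewrite inE eq_sym.
Qed.

Lemma tree_nbrs_sym u v : (v \in tree_nbrs u) = (u \in tree_nbrs v).
Proof. by rewrite !mem_tree_nbrs orbC. Qed.

Lemma tree_nbrs_loopless u : u \notin tree_nbrs u.
Proof.
rewrite mem_tree_nbrs orbb; apply/negP => /andP[u0 /eqP e].
by have := par_lt t u0; rewrite e ltnn.
Qed.

Definition tree_board := Board tree_nbrs_sym tree_nbrs_loopless.

Lemma tree_gadj u v : gadj tree_board u v =
  ((0 < u)%N && (par t u == v)) || ((0 < v)%N && (par t v == u)).
Proof. exact: mem_tree_nbrs. Qed.

Lemma ch_gt u v : u \in ch t v -> (v < u)%N.
Proof. by rewrite mem_ch => /andP[u0 /eqP <-]; exact: par_lt. Qed.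

(* The root is treated as if it had a yellow parent, which imposes nothing. *)
Definition parent_color (xi : config) v : color := if v is _.+1 then xi (par t v) else Yellow.

Lemma parent_color_agree n v (phi psi : config) : (v < n)%N ->
  agree (fun v => (v < n.-1)%N) phi psi -> parent_color phi v = parent_color psi v.
Proof.
case: v => // v vn h; apply: h => /=; have := par_lt t (ltn0Sn v).
by move: vn; case: n => //= n; lia.
Qed.

Lemma tree_homP xi :
  is_hom tree_board xi <-> forall v, hinge_adj (parent_color xi v) (xi v).
Proof.
split=> [h [|v]|h u v] //; first by rewrite hinge_adjC; apply: h; rewrite tree_gadj eqxx.
rewrite tree_gadj => /orP[/andP[u0 /eqP <-]|/andP[v0 /eqP <-]].
  by rewrite hinge_adjC; case: u u0 => // u _; exact: (h u.+1).
by case: v v0 => // v _; exact: (h v.+1).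
Qed.

(** * Markov chains given by vertex weights *)

Section MarkovChain.
Variable R : realType.
Implicit Types w : nat -> color -> R.

(** With [w v c'] read as the weight of the subtree at [v] when [v] has colour [c'], this is the
    message that [v] sends to a parent of colour [c]. *)
Definition msg w v c : R := \sum_(c' : color) (hinge_adj c c')%:R * w v c'.

Definition ker w v c c' : R := (hinge_adj c c')%:R * w v c' / msg w v c.

Definition path_prob w n xi : R := \prod_(v < n) ker w v (parent_color xi v) (xi v).

Lemma ker_sum w v c : msg w v c != 0 -> \sum_(c' : color) ker w v c c' = 1.
Proof. by move=> m0; rewrite /ker -mulr_suml divff. Qed.

Lemma path_prob_depends_on w n : depends_on (fun v => (v < n)%N) (path_prob w n).
Proof.
move=> phi psi h; apply: eq_bigr => v _; rewrite h //; congr (ker _ _ _ _).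
apply: (@parent_color_agree n) => // u un; apply: h.
exact: leq_trans un (leq_pred _).
Qed.

Lemma path_probS w n xi :
  path_prob w n.+1 xi = path_prob w n xi * ker w n (parent_color xi n) (xi n).
Proof. by rewrite /path_prob big_ord_recr. Qed.

Lemma path_prob_sum w n xi : msg w n (parent_color xi n) != 0 ->
  \sum_(c : color) path_prob w n.+1 (upd xi n c) = path_prob w n xi.
Proof.
move=> m0; have h c : path_prob w n.+1 (upd xi n c) =
    path_prob w n xi * ker w n (parent_color xi n) c.
  rewrite path_probS upd_same; congr (_ * ker _ _ _ _).
    by apply: path_prob_depends_on => v vn; rewrite /upd ltn_eqF.
  apply: (@parent_color_agree n.+1) => // v vn; by rewrite /upd ltn_eqF.
by rewrite (eq_bigr _ (fun c _ => h c)) -mulr_sumr ker_sum // mulr1.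
Qed.

(** Double counting of the edges in the initial segment: by parent on the left, by child on the
    right. *)
Lemma prod_children n (f : nat -> nat -> R) :
  \prod_(v < n.+1) \prod_(u <- ch t v | (u < n.+1)%N) f u v =
  \prod_(u < n.+1 | (0 < u)%N) f u (par t u).
Proof.
have e (v : 'I_n.+1) : \prod_(u <- ch t v | (u < n.+1)%N) f u v =
    \prod_(u < n.+1 | (0 < u)%N && (inord (par t u) == v)) f u (par t u).
  rewrite -(big_mkord (fun u => (0 < u)%N && (inord (par t u) == v)) (fun u => f u (par t u))).
  rewrite -big_filter -[RHS]big_filter.
  rewrite [RHS](eq_big_seq (fun u => f u v)); last first.
    move=> u; rewrite mem_filter mem_index_iota => /andP[/andP[u0 /eqP pu] un].
    congr (f u _); rewrite -pu inordK //; apply: ltn_trans (par_lt t u0) _.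
    by move: un; case/andP.
  apply: perm_big; apply: uniq_perm; rewrite ?filter_uniq ?ch_uniq ?iota_uniq // => u.
  rewrite !mem_filter mem_index_iota mem_ch andbC; case: (ltnP 0 u) => u0 //=.
  case un : (u < n.+1)%N; rewrite ?andbF ?andbT //.
  by rewrite -val_eqE /= inordK // (ltn_trans (par_lt t u0)).
rewrite (eq_bigr _ (fun v _ => e v)).
by rewrite [RHS](partition_big (fun u : 'I_n.+1 => inord (par t u) : 'I_n.+1) predT).
Qed.

(** Each denominator [msg w u] is moved from the child [u] to its parent, whose colour it depends
    on. Apart from the hard constraints, the probability becomes a product of one-site terms; only
    the message of the root is left over. *)
Lemma path_prob_factor w n xi : path_prob w n.+1 xi =
  (msg w 0 Yellow)^-1 * [forall v : 'I_n.+1, hinge_adj (parent_color xi v) (xi v)]%:R *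
  \prod_(v < n.+1) (w v (xi v) / \prod_(u <- ch t v | (u < n.+1)%N) msg w u (xi v)).
Proof.
rewrite /path_prob /ker !big_split /= !prodfV (prod_children n (fun u v => msg w u (xi v))).
rewrite -(prodr_natb _ xpredT).
have -> : \prod_(v < n.+1) msg w v (parent_color xi v) =
    msg w 0 Yellow * \prod_(u < n.+1 | (0 < u)%N) msg w u (xi (par t u)).
  rewrite (bigD1 ord0) //=; congr (_ * _); apply: eq_big => [u|u u0].
    by rewrite -val_eqE /= lt0n.
  by case: u u0 => [[|u] hu].
by rewrite invfM; ring.
Qed.

(** * Solutions of the weight recursion, up to scaling, give Gibbs measures *)

Section Gibbs.
Variables (mu : color -> R) (w : nat -> color -> R) (kappa : nat -> R).
Hypothesis mu_gt0 : forall c, 0 < mu c.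
Hypothesis w_gt0 : forall v c, 0 < w v c.
Hypothesis kappa_neq0 : forall v, kappa v != 0.
Hypothesis w_eq : forall v c, kappa v * w v c = mu c * \prod_(u <- ch t v) msg w u c.

Lemma msg_gt0 v c : 0 < msg w v c.
Proof.
rewrite /msg big_color /=; have := w_gt0 v Yellow; have := w_gt0 v Green; have := w_gt0 v Red.
by case: c => /=; lra.
Qed.

Lemma ker_ge0 v c c' : 0 <= ker w v c c'.
Proof. by rewrite /ker divr_ge0 ?mulr_ge0 // ltW // msg_gt0. Qed.

Lemma path_prob_ge0 n xi : 0 <= path_prob w n xi.
Proof. by apply: prodr_ge0 => v _; exact: ker_ge0. Qed.

(** For [v] in [U] all children lie in the window, so by [w_eq] the one-site term in
    [path_prob_factor] reduces to [mu] divided by [kappa v]. All other factors are functions of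
    [psi]. *)
Lemma path_prob_weight (U : {fset nat}) n : (forall v, v \in Uplus tree_board U -> (v < n.+1)%N) ->
  exists C : config -> R, forall eta psi,
    path_prob w n.+1 (glue U eta psi) = C psi * weight_at tree_board mu U (glue U eta psi).
Proof.
move=> Un.
pose chm xi v := \prod_(u <- ch t v | (u < n.+1)%N) msg w u (xi v).
(* Constraints on edges with both ends outside [U]. Some of these edges lie in [Uplus tree_board U]
   and are checked twice, which is harmless for 0/1 factors. *)
pose rest (psi : config) := [forall u : 'I_n.+1, forall v : 'I_n.+1,
  (val u \notin U) ==> (val v \notin U) ==> gadj tree_board u v ==> hinge_adj (psi u) (psi v)].
have UU v : v \in U -> v \in Uplus tree_board U by move=> ?; exact: sub_Uplus.
exists (fun psi => (msg w 0 Yellow)^-1 * (rest psi)%:R *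
  (\prod_(v < n.+1 | val v \notin U) (w v (psi v) / chm psi v)) *
  (\prod_(v < n.+1 | val v \in U) (kappa v)^-1) /
  (\prod_(v : Uplus tree_board U | val v \notin U) mu (psi (val v)))) => eta psi.
set xi := glue U eta psi.
have xiN v : v \notin U -> xi v = psi v by move=> vU; rewrite /xi /glue (negPf vU).
rewrite path_prob_factor weight_atE.
have -> : [forall v : 'I_n.+1, hinge_adj (parent_color xi v) (xi v)] =
    hom_on tree_board (restr (Uplus tree_board U) xi) && rest psi.
  apply/forallP/andP => [h|[/forallP h1 /forallP h2] v].
    have hh u v : (u < n.+1)%N -> (v < n.+1)%N -> gadj tree_board u v -> hinge_adj (xi u) (xi v).
      move=> un vn; rewrite tree_gadj => /orP[/andP[u0 /eqP <-]|/andP[v0 /eqP <-]].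
        by rewrite hinge_adjC; have := h (Ordinal un); case: u un u0.
      by have := h (Ordinal vn); case: v vn v0.
    split.
      apply/forallP => u; apply/forallP => v; rewrite !ffunE; apply/implyP.
      by apply: hh; apply: Un; exact: valP.
    apply/forallP => u; apply/forallP => v; apply/implyP => uU; apply/implyP => vU; apply/implyP => uv.
    by rewrite -!xiN //; exact: hh.
  case: v => -[|v] vn //=.
  have pn : (par t v.+1 < n.+1)%N by apply: ltn_trans vn; exact: par_lt.
  have adj : gadj tree_board (par t v.+1) v.+1 by rewrite tree_gadj /= eqxx orbT.
  case: (boolP ((par t v.+1 \in U) || (v.+1 \in U))) => [hU|].
    have pU : par t v.+1 \in Uplus tree_board U.
      rewrite mem_Uplus; case/orP: hU => [->//|hU]; apply/orP; right; apply/hasP; exists v.+1 => //.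
      by rewrite tree_gadj /= eqxx.
    have vU : v.+1 \in Uplus tree_board U.
      rewrite mem_Uplus; case/orP: hU => [hU|->//]; apply/orP; right; apply/hasP.
      by exists (par t v.+1).
    have /forallP/(_ [` vU]%fset) := h1 [` pU]%fset.
    by rewrite /= adj !ffunE.
  rewrite negb_or => /andP[pU vU].
  have /forallP/(_ (Ordinal vn)) := h2 (Ordinal pn).
  by rewrite /= pU vU adj /= !xiN.
have -> : \prod_(v < n.+1) (w v (xi v) / chm xi v) =
   (\prod_(v < n.+1 | val v \notin U) (w v (psi v) / chm psi v)) *
  (\prod_(v < n.+1 | val v \in U) (kappa v)^-1) * \prod_(v < n.+1 | val v \in U) mu (xi v).
  rewrite (bigID (fun v : 'I_n.+1 => val v \in U)) /= mulrC -mulrA; congr (_ * _).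
    by apply: eq_bigr => v vU; rewrite /chm xiN.
  rewrite -big_split /=; apply: eq_bigr => v vU.
  have -> : chm xi v = \prod_(u <- ch t v) msg w u (xi v).
    rewrite /chm big_seq_cond [RHS]big_seq_cond; apply: eq_bigl => u.
    case uv : (u \in ch t v) => //=; rewrite Un // mem_Uplus; apply/orP; right; apply/hasP.
    by exists (val v) => //; rewrite tree_gadj; move: uv; rewrite mem_ch => ->; rewrite orbT.
  have p0 : \prod_(u <- ch t v) msg w u (xi v) != 0.
    by rewrite gt_eqF // prodr_gt0 // => u _; exact: msg_gt0.
  apply: (mulfI (kappa_neq0 v)); rewrite mulrA w_eq mulfK //.
  by rewrite mulrA divff // mul1r.
have -> : \prod_(v : Uplus tree_board U) mu (xi (val v)) =
   (\prod_(v < n.+1 | val v \in U) mu (xi v)) *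
   \prod_(v : Uplus tree_board U | val v \notin U) mu (psi (val v)).
  rewrite (bigID (fun v : Uplus tree_board U => val v \in U)) /=; congr (_ * _); last first.
    by apply: eq_bigr => v vU; rewrite xiN.
  by apply: (prod_fset_ord (fun v => mu (xi v))) => v vU; [exact: UU|exact/Un/UU].
set X := \prod_(v : Uplus tree_board U | _) _.
have X0 : X != 0 by rewrite gt_eqF // prodr_gt0.
set K := (msg w 0 Yellow)^-1.
by rewrite -mulnb natrM; field; exact: X0.
Qed.

(** A forbidden edge above [v] makes the factor [ker] at [v] vanish, so a violation at [v] has
    probability 0; there are countably many [v]. *)
Lemma hom_almost_surely (P : probability Config R) :
  (forall n xi, P (cell (fun v => (v < n)%N) xi) = (path_prob w n xi)%:E) ->
  P [set phi : config | is_hom tree_board phi]%classic = 1%E.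
Proof.
move=> Pq.
pose bad v : set config := [set phi | ~~ hinge_adj (parent_color phi v) (phi v)]%classic.
have bad_dep v : depends_on (mem (iota 0 v.+1)) (bad v).
  move=> phi psi h; rewrite /bad /= h; last by rewrite mem_iota0.
  rewrite (@parent_color_agree v.+1 v phi psi) // => u uv; apply: h.
  by rewrite mem_iota0; lia.
have mbad v : measurable (bad v : set Config) by exact: depends_on_measurable (bad_dep v).
have bad0 v : P (bad v) = 0%E.
  rewrite -[bad v]setTI.
  apply: etrans (@eq_measure_cells R P mzero (iota 0 v.+1) (bad v) (iota_uniq _ _) (mbad v) _ setT _) _ => //.
  move=> xi; change (P (cell (mem (iota 0 v.+1)) xi `&` bad v)%classic = 0%E).
  have e : cell (mem (iota 0 v.+1)) xi = cell (fun u => (u < v.+1)%N) xi.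
    by apply: eq_cell => // u; rewrite mem_iota0.
  case: (boolP (hinge_adj (parent_color xi v) (xi v))) => hx.
    rewrite (_ : (_ `&` _)%classic = set0) ?measure0 //.
    apply/seteqP; split=> // phi [h]; rewrite /bad /= h; last by rewrite mem_iota0.
    rewrite (@parent_color_agree v.+1 v phi xi) ?hx // => u uv; apply: h.
    by rewrite mem_iota0; lia.
  apply/eqP; rewrite eq_le measure_ge0 andbT.
  apply: le_trans (_ : P (cell (mem (iota 0 v.+1)) xi) <= _)%E.
    apply: le_measure; rewrite ?inE; last by move=> phi [].
      by apply: (@measurableI _ Config) => //; exact: (@measurable_cell (iota 0 v.+1)).
    exact: (@measurable_cell (iota 0 v.+1)).
  by rewrite e Pq path_probS /ker (negPf hx) !mul0r mulr0.
have -> : [set phi : config | is_hom tree_board phi]%classic = (~` \bigcup_v bad v)%classic.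
  apply/seteqP; split=> phi /=.
    by move=> /tree_homP h [v _] /=; rewrite /bad /= h.
  move=> h; apply/tree_homP => v; apply: contrapT => /negP hv; apply: h; by exists v.
rewrite probability_setC; last exact: bigcupT_measurable.
suff -> : P (\bigcup_v bad v)%classic = 0%E by rewrite sube0.
apply/(@negligibleP _ _ _ P); first exact: bigcupT_measurable.
apply: negligible_bigcup => v.
by apply/(@negligibleP _ _ _ P); [exact: mbad|exact: bad0].
Qed.

Theorem tree_gibbs_exists : exists P : probability Config R, is_gibbs tree_board mu P /\
  forall n xi, P (cell (fun v => (v < n)%N) xi) = (path_prob w n xi)%:E.
Proof.
have [||||P Pq] := @cylinder_measure R (path_prob w).
- by move=> xi; rewrite /path_prob big_ord0.
- exact: path_prob_ge0.
- exact: path_prob_depends_on.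
- by move=> n xi; rewrite path_prob_sum // gt_eqF // msg_gt0.
exists P; split=> //; apply: (gibbs_of_cylinders mu_gt0 _ Pq); first exact: hom_almost_surely.
move=> U; have [n hn] := seq_bounded (enum_fset (Uplus tree_board U)).
exists n.+1 => -[|k] // nk; apply: path_prob_weight => v vU; exact: ltn_trans (hn v vU) _.
Qed.
End Gibbs.
End MarkovChain.
End Tree.

(** * Boundary conditions and uniqueness *)

Section SumonPerm.
Variable R : realType.
Implicit Types (s : seq nat) (F : config -> R) (psi : config).

Lemma updC xi u v c c' : u != v -> upd (upd xi u c) v c' = upd (upd xi v c') u c.
Proof.
move=> uv; apply/funext => x; rewrite /upd; case: (eqVneq x v) => // ->.
by rewrite eq_sym (negPf uv).
Qed.

Lemma sumon_rcons s v F psi :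
  sumon (rcons s v) F psi = sumon s (fun xi => \sum_(c : color) F (upd xi v c)) psi.
Proof. by elim: s psi => [|u s IH] psi //=; apply: eq_bigr => c _; exact: IH. Qed.

Lemma sumon_move s1 s2 v F psi : uniq (s1 ++ v :: s2) ->
  sumon (s1 ++ v :: s2) F psi = sumon (v :: s1 ++ s2) F psi.
Proof.
elim: s1 psi => [|u s1 IH] psi //= /andP[us1 us].
have uv : u != v by apply: contra us1 => /eqP ->; rewrite mem_cat mem_head orbT.
rewrite exchange_big /=; apply: eq_bigr => c _; rewrite IH //=.
by apply: eq_bigr => c' _; rewrite updC.
Qed.

(** Needed because a finite set is enumerated in an unspecified order, whereas a Markov chain must
    be summed out from the last site downwards. *)
Lemma sumon_perm s s' F psi : uniq s -> perm_eq s s' -> sumon s F psi = sumon s' F psi.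
Proof.
elim: s s' psi => [|v s IH] s' psi /=; first by rewrite perm_sym => _ /perm_nilP ->.
move=> /andP[vs us] ps.
have us' : uniq s' by rewrite -(perm_uniq ps) /= vs us.
have vs' : v \in s' by rewrite -(perm_mem ps) mem_head.
case/splitPr: vs' us' ps => s1 s2 us' ps.
rewrite sumon_move //=; apply: eq_bigr => c _; apply: IH => //.
by rewrite -(perm_cons v) (perm_trans ps) // perm_catC /= perm_cons perm_catC.
Qed.
End SumonPerm.

Lemma cvg_prod_ord (R : realType) n (F : nat -> nat -> R) (l : nat -> R) :
  (forall v, F M v @[M --> \oo] --> l v)%classic ->
  (\prod_(v < n) F M v @[M --> \oo] --> \prod_(v < n) l v)%classic.
Proof.
move=> Fl; elim: n => [|n IH].
  under eq_fun do rewrite big_ord0; rewrite big_ord0; exact: cvg_cst.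
under eq_fun do rewrite big_ord_recr; rewrite big_ord_recr /=.
by apply: cvgM; [exact: IH|exact: Fl].
Qed.

(** * Finite patches with a fixed boundary condition *)

Section BoundaryWeights.
Variables (t : tree) (R : realType) (mu : color -> R).
Hypothesis mu_gt0 : forall c, 0 < mu c.
Implicit Types (psi : config) (N k v : nat).

(* The weights obtained by fixing the sites outside [0, N) as in [psi]; the
   number [k] is the fuel of the recursion towards the leaves. *)
Fixpoint boundary_rec k N psi v (c : color) : R :=
  if k is k'.+1 then
    if (v < N)%N then mu c * \prod_(u <- ch t v) msg (boundary_rec k' N psi) u c
    else (c == psi v)%:R
  else (c == psi v)%:R.

Definition boundary_weight N psi := boundary_rec N N psi.

Lemma boundary_rec_out k N psi v c : (N <= v)%N -> boundary_rec k N psi v c = (c == psi v)%:R.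
Proof. by case: k => //= k Nv; rewrite ltnNge Nv. Qed.

(** Children have larger numbers than their parent, so the recursion from [v] leaves [0, N) after at
    most [N - v] steps. *)
Lemma boundary_rec_fuel k k' N psi v c : (N - v <= k)%N -> (N - v <= k')%N ->
  boundary_rec k N psi v c = boundary_rec k' N psi v c.
Proof.
elim: k k' v c => [|k IH] k' v c; case: (leqP N v) => Nv kv kv'; rewrite ?(boundary_rec_out _ _ _ Nv) //.
  by move: kv; rewrite leqn0 subn_eq0 leqNgt Nv.
case: k' kv' => [|k'] kv' /=; first by move: kv'; rewrite leqn0 subn_eq0 leqNgt Nv.
rewrite Nv; congr (_ * _); apply: eq_big_seq => u /ch_gt uv; apply: eq_bigr => c' _.
by congr (_ * _); apply: IH; lia.
Qed.

Lemma boundary_weight_out N psi v c : (N <= v)%N -> boundary_weight N psi v c = (c == psi v)%:R.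
Proof. exact: boundary_rec_out. Qed.

Lemma boundary_weight_in N psi v c : (v < N)%N ->
  boundary_weight N psi v c = mu c * \prod_(u <- ch t v) msg (boundary_weight N psi) u c.
Proof.
case: N => // N vN; rewrite {1}/boundary_weight /= vN; congr (_ * _).
apply: eq_big_seq => u /ch_gt uv; apply: eq_bigr => c' _; congr (_ * _).
by apply: boundary_rec_fuel; lia.
Qed.

Lemma boundary_rec_ge0 k N psi v c : 0 <= boundary_rec k N psi v c.
Proof.
elim: k v c => [|k IH] v c //=; case: ifP => // _.
rewrite mulr_ge0 ?(ltW (mu_gt0 _)) // prodr_ge0 // => u _.
by apply: sumr_ge0 => c' _; rewrite mulr_ge0.
Qed.

Lemma msg_boundary_out N psi v c : (N <= v)%N ->
  msg (boundary_weight N psi) v c = (hinge_adj c (psi v))%:R.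
Proof.
move=> Nv; rewrite /msg (bigD1 (psi v)) //= boundary_weight_out // eqxx mulr1.
by rewrite big1 ?addr0 // => c' nc; rewrite boundary_weight_out // (negPf nc) mulr0.
Qed.

(** Yellow is compatible with every colour. *)
Lemma msg_yellow_gt0 (w : nat -> color -> R) v : (forall c, 0 <= w v c) -> 0 < w v Yellow ->
  forall c, 0 < msg w v c.
Proof.
move=> w0 wY c; rewrite /msg big_color /=.
by have := w0 Green; have := w0 Red; case: c => /=; lra.
Qed.

Lemma boundary_weight_yellow_gt0 N psi v : (v < N)%N -> 0 < boundary_weight N psi v Yellow.
Proof.
move: {2}(N - v)%N (leqnn (N - v)) => k; elim: k v => [|k IH] v; first by lia.
move=> kv vN; rewrite boundary_weight_in // mulr_gt0 // big_seq prodr_gt0 // => u /ch_gt uv.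
case: (leqP N u) => Nu; first by rewrite msg_boundary_out.
by apply: msg_yellow_gt0 => [c|]; [exact: boundary_rec_ge0|apply: IH => //; lia].
Qed.

Lemma msg_boundary_gt0 N psi v c : (v < N)%N -> 0 < msg (boundary_weight N psi) v c.
Proof.
move=> vN; apply: msg_yellow_gt0; last exact: boundary_weight_yellow_gt0.
by move=> c'; exact: boundary_rec_ge0.
Qed.

Lemma boundary_rec_depends_on k N M v c : (v < M)%N ->
  (forall u v, (v < N)%N -> u \in ch t v -> (u < M)%N) ->
  depends_on (fun v => (v < M)%N) (fun psi => boundary_rec k N psi v c).
Proof.
move=> vM NM phi psi h; elim: k v c vM => [|k IH] v c vM /=; first by rewrite h.
case: ifP => vN; last by rewrite h.
congr (_ * _); apply: eq_big_seq => u uv; apply: eq_bigr => c' _.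
by rewrite IH // (NM u v).
Qed.

Lemma ker_boundary_ge0 N psi v c c' : 0 <= ker (boundary_weight N psi) v c c'.
Proof.
rewrite /ker divr_ge0 ?mulr_ge0 ?boundary_rec_ge0 //.
by apply: sumr_ge0 => c1 _; rewrite mulr_ge0 ?boundary_rec_ge0.
Qed.

Lemma ker_boundary_le1 N psi v c c' : ker (boundary_weight N psi) v c c' <= 1.
Proof.
case: (eqVneq (msg (boundary_weight N psi) v c) 0) => [m0|m0].
  by rewrite /ker m0 invr0 mulr0.
rewrite -(ker_sum m0) (bigD1 c') //= lerDl; apply: sumr_ge0 => c1 _.
exact: ker_boundary_ge0.
Qed.

Definition initial N : {fset nat} := seq_fset tt (iota 0 N).

Lemma mem_initial N v : (v \in initial N) = (v < N)%N.
Proof. by rewrite seq_fsetE mem_iota. Qed.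

Lemma sumon_path_prob (w : nat -> color -> R) N psi :
  (forall v c, (v < N)%N -> msg w v c != 0) ->
  sumon (enum_fset (initial N)) (path_prob t w N) psi = 1.
Proof.
move=> m0; rewrite (@sumon_perm _ _ (iota 0 N)) ?fset_uniq //; last first.
  by apply: uniq_perm; rewrite ?fset_uniq ?iota_uniq // => v; rewrite seq_fsetE.
elim: N m0 => [|N IH] m0; first by rewrite /= /path_prob big_ord0.
rewrite -addn1 iotaD cats1 sumon_rcons add0n addn1 -[RHS]IH; last first.
  by move=> v c vN; apply: m0; exact: ltnW.
by apply: eq_sumon => xi _; apply: path_prob_sum; exact: m0.
Qed.

(** Conditioning a tree on the colours outside an initial segment leaves a Markov chain, driven by
    the boundary weights. Its path probability is proportional to the patch weight and sums to 1, so
    [spec_prop] identifies it with the specification. *)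
Lemma spec_initial N psi eta :
  spec (tree_board t) mu (initial N.+1) eta psi = path_prob t (boundary_weight N.+1 psi) N.+1 eta.
Proof.
set n := N.+1; set w := boundary_weight n psi; set U := initial n.
have gU eta' : path_prob t w n (glue U eta' psi) = path_prob t w n eta'.
  by apply: path_prob_depends_on => v vn; rewrite /glue mem_initial vn.
pose X := \prod_(v : Uplus (tree_board t) U | val v \notin U) mu (psi (val v)).
have X0 : X != 0 by rewrite gt_eqF // prodr_gt0.
rewrite -[RHS]gU (@spec_prop _ (tree_board t) _ mu_gt0 (path_prob t w n) ((msg w 0 Yellow)^-1 / X)).
  rewrite sumon_path_prob ?mulr1 // => v c vn; by rewrite gt_eqF // msg_boundary_gt0.
move=> eta'; set xi := glue U eta' psi.
have xi_out v : (n <= v)%N -> xi v = psi v by move=> nv; rewrite /xi /glue mem_initial ltnNge nv.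
rewrite path_prob_factor weight_atE -/n.
(* The constraints on edges leaving the segment. In the chain they come from the messages of outside
   children, in the patch weight from [hom_on]. *)
pose bd := \prod_(v < n) \prod_(u <- ch t v | (n <= u)%N) (hinge_adj (xi v) (psi u))%:R : R.
have e1 : \prod_(v < n) (w v (xi v) / \prod_(u <- ch t v | (u < n)%N) msg w u (xi v)) =
    (\prod_(v < n) mu (xi v)) * bd.
  rewrite /bd -big_split /=; apply: eq_bigr => v _.
  rewrite {1}/w boundary_weight_in // -/w (bigID (fun u => (u < n)%N)) /= -mulrA; congr (_ * _).
  rewrite mulrAC divff ?mul1r; last first.
    by rewrite gt_eqF // prodr_gt0 // => u un; exact: msg_boundary_gt0.
  apply: eq_big => [u|u un]; first by rewrite -leqNgt.
  by rewrite msg_boundary_out // leqNgt.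
have e2 : ((hom_on (tree_board t) (restr (Uplus (tree_board t) U) xi))%:R : R) =
    [forall v : 'I_n, hinge_adj (parent_color t xi v) (xi v)]%:R * bd.
  have -> : bd = [forall v : 'I_n, all (fun u => (n <= u)%N ==> hinge_adj (xi v) (psi u)) (ch t v)]%:R.
    rewrite /bd -(prodr_natb _ xpredT); apply: eq_bigr => v _.
    exact: (prodr_seq_natb _ (ch t v) (fun u => (n <= u)%N) (fun u => hinge_adj (xi v) (psi u))).
  rewrite -natrM mulnb; congr (_%:R).
  have inU v : (v < n)%N -> v \in Uplus (tree_board t) U.
    by move=> vn; rewrite sub_Uplus // seq_fsetE mem_iota.
  congr nat_of_bool; apply/forallP/andP => [h|[/forallP h1 /forallP h2]].
    have hh a b : a \in Uplus (tree_board t) U -> b \in Uplus (tree_board t) U ->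
        gadj (tree_board t) a b -> hinge_adj (xi a) (xi b).
      by move=> aU bU; have /forallP/(_ [` bU]%fset)/implyP := h [` aU]%fset; rewrite !ffunE.
    split.
      apply/forallP => -[[|v] vn] //=; apply: hh; rewrite ?tree_gadj ?eqxx ?orbT //; apply: inU => //.
      by apply: ltn_trans vn; exact: par_lt.
    apply/forallP => v; apply/allP => u uv; apply/implyP => nu; rewrite -xi_out //.
    have adj : gadj (tree_board t) v u by rewrite tree_gadj; move: uv; rewrite mem_ch => ->; rewrite orbT.
    apply: hh => //; first exact: inU.
    rewrite mem_Uplus; apply/orP; right; apply/hasP; exists (val v) => //.
    by rewrite mem_initial; exact: ltn_ord.
  have key u v : v \in Uplus (tree_board t) U -> (0 < v)%N -> par t v = u -> hinge_adj (xi u) (xi v).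
    move=> vU v0 pv; case: (ltnP v n) => vn.
      by have := h1 (Ordinal vn); rewrite /= -pv; case: v {vU pv vn} v0.
    move: vU; rewrite mem_Uplus mem_initial => /orP[|/hasP[u' u'U]]; first by rewrite ltnNge vn.
    have un' : (u' < n)%N by rewrite -(mem_initial n u').
    rewrite tree_gadj => /orP[/andP[u0 /eqP e]|/andP[_ /eqP e]].
      by have := par_lt t u0; rewrite e; lia.
    have /allP/(_ v) := h2 (Ordinal un').
    rewrite (_ : u = u'); last by rewrite -pv.
    by rewrite mem_ch v0 e eqxx vn /= (xi_out v) //; apply.
  move=> a; apply/forallP => b; rewrite !ffunE; apply/implyP; rewrite tree_gadj.
  move=> /orP[/andP[a0 /eqP e]|/andP[b0 /eqP e]]; last by apply: key => //; exact: valP.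
  by rewrite hinge_adjC; apply: key => //; exact: valP.
have e3 : \prod_(v : Uplus (tree_board t) U) mu (xi (val v)) = (\prod_(v < n) mu (xi v)) * X.
  rewrite (bigID (fun v : Uplus (tree_board t) U => val v \in U)) /=; congr (_ * _); last first.
    by apply: eq_bigr => v; rewrite mem_initial -leqNgt => nv; rewrite xi_out.
  rewrite (prod_fset_ord (n := n) (fun v => mu (xi v))).
  - by apply: eq_bigl => v; rewrite mem_initial ltn_ord.
  - by move=> v vU; exact: sub_Uplus.
  - by move=> v; rewrite mem_initial.
rewrite e1 e2 e3; set K := (msg w 0 Yellow)^-1; by field; exact: X0.
Qed.

Lemma path_prob_boundary_measurable N n eta : (n <= N)%N ->
  measurable_fun setT (fun psi : Config => (path_prob t (boundary_weight N psi) n eta)%:E).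
Proof.
move=> nN; have [M hM] := seq_bounded (flatten [seq ch t v | v <- iota 0 N] ++ iota 0 N).
have NM v : (v < N)%N -> (v < M)%N.
  by move=> vN; apply: hM; rewrite mem_cat mem_iota vN orbT.
have chM u v : (v < N)%N -> u \in ch t v -> (u < M)%N.
  move=> vN uv; apply: hM; rewrite mem_cat; apply/orP; left.
  by apply/flatten_mapP; exists v => //; rewrite mem_iota.
apply/measurable_EFinP; apply: (@depends_on_measurable_fun (iota 0 M)) => phi psi h.
have e v c : (v < N)%N -> boundary_weight N phi v c = boundary_weight N psi v c.
  move=> vN; apply: (@boundary_rec_depends_on N N M) => //; first exact: NM.
  by move=> u uM; apply: h; rewrite mem_iota0.
apply: eq_bigr => v _; have vN := leq_trans (ltn_ord v) nN.
rewrite /ker /msg e //; congr (_ / _); apply: eq_bigr => c _; by rewrite e.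
Qed.

(** Downward induction on [n]. For [n = N.+1] this is the Gibbs property with the whole space as
    outside event; summing over the colour of site [n] gives the smaller windows. *)
Lemma gibbs_cell_integral (P : probability Config R) N n eta : is_gibbs (tree_board t) mu P ->
  (n <= N.+1)%N ->
  P (cell (fun v => (v < n)%N) eta) =
  (\int[P]_psi (path_prob t (boundary_weight N.+1 psi) n eta)%:E)%E.
Proof.
move=> [_ Pg]; move: {2}(N.+1 - n)%N (leqnn (N.+1 - n)) => k.
elim: k n eta => [|k IH] n eta kn nN.
  have -> : n = N.+1 by lia.
  have := Pg (initial N.+1) eta setT (@measurableT _ (g_sigma_algebraType _)).
  rewrite setIT => h; apply: etrans (etrans _ h) _.
    congr (P _); apply/seteqP; split=> phi hp v; first by rewrite mem_initial => /hp.
    by move=> vn; apply: hp; rewrite mem_initial.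
  by apply: eq_integral => psi _; rewrite spec_initial.
case: (ltnP N n) => Nn; first by apply: IH; lia.
rewrite (@measure_split _ _ _ n); last exact: (@depends_on_measurable_lt n _ (@depends_on_cell _ _)).
under eq_integral => psi _.
  rewrite -(path_prob_sum (n := n)); last by rewrite gt_eqF // msg_boundary_gt0.
  rewrite -sumEFin; over.
rewrite ge0_integral_sum //.
- apply: eq_bigr => c _; rewrite (@cell_upd _ (fun v => (v < n.+1)%N)) ?ltnn //.
    by apply: IH => //; lia.
  by move=> u; rewrite ltnS leq_eqVlt.
- by move=> c; apply: path_prob_boundary_measurable.
- by move=> c psi _; rewrite lee_fin; apply: prodr_ge0 => v _; exact: ker_boundary_ge0.
Qed.

(** * Uniqueness from convergence of the boundary kernels *)

Section Uniqueness.
Variables (w : nat -> color -> R) (kappa : nat -> R) (Ns : nat -> nat).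
Hypothesis w_gt0 : forall v c, 0 < w v c.
Hypothesis kappa_neq0 : forall v, kappa v != 0.
Hypothesis w_eq : forall v c, kappa v * w v c = mu c * \prod_(u <- ch t v) msg w u c.
Hypothesis Ns_ge : forall n, (n <= Ns n)%N.
Hypothesis ker_cvg : forall psi v c c',
  (ker (boundary_weight (Ns n) psi) v c c' @[n --> \oo] --> ker w v c c')%classic.

(** Let the patch grow in [gibbs_cell_integral]: the integrand lies between 0 and 1 and converges to
    a constant for every [psi], so dominated convergence applies. *)
Lemma gibbs_cell (P : probability Config R) n eta : is_gibbs (tree_board t) mu P ->
  P (cell (fun v => (v < n)%N) eta) = (path_prob t w n eta)%:E.
Proof.
move=> Pg.
(* The shift by [n.+1] makes every patch of the sequence contain the window [0, n). *)
pose f M (psi : Config) := (path_prob t (boundary_weight (Ns (M + n.+1)) psi) n eta)%:E.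
have nNs M : (n < Ns (M + n.+1))%N by apply: leq_trans (Ns_ge _); rewrite leq_addl.
have fI M : (\int[P]_psi f M psi = P (cell (fun v => (v < n)%N) eta))%E.
  rewrite /f; have := nNs M; case: (Ns _) => // k nk.
  by rewrite (@gibbs_cell_integral P k) // ltnW.
have [] := @dominated_convergence _ Config R P setT measurableT f
  (cst (path_prob t w n eta)%:E) (cst 1%E).
- by move=> M; apply: path_prob_boundary_measurable; exact: ltnW.
- exact: measurable_cst.
- apply: aeW => psi _; apply: cvg_EFin; first exact: nearW.
  rewrite /f /comp /=; apply: (@cvg_prod_ord _ n (fun M v =>
    ker (boundary_weight (Ns (M + n.+1)) psi) v (parent_color t eta v) (eta v))
    (fun v => ker w v (parent_color t eta v) (eta v))) => v.
  have := @ker_cvg psi v (parent_color t eta v) (eta v).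
  by rewrite -(cvg_shiftn n.+1).
- exact: finite_measure_integrable_cst.
- apply: aeW => psi M _; rewrite /f /= lee_fin ger0_norm.
    by apply: prodr_ile1 => v _; rewrite ker_boundary_ge0 ker_boundary_le1.
  by apply: prodr_ge0 => v _; exact: ker_boundary_ge0.
have I1 : (\int[P]_x cst (path_prob t w n eta)%:E x = (path_prob t w n eta)%:E)%E.
  by rewrite integral_cst // -[RHS]mule1; congr (_ * _)%E; exact: probability_setT.
move=> _ _; rewrite I1.
under eq_fun do rewrite fI.
by move=> /(cvg_lim (@ereal_hausdorff R)) <-; apply/esym; exact: lim_cst.
Qed.

Theorem tree_unique_gibbs : unique_gibbs (tree_board t) mu.
Proof.
split; first by have [P [Pg _]] := tree_gibbs_exists mu_gt0 w_gt0 kappa_neq0 w_eq; exists P.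
move=> P1 P2 g1 g2 A mA.
pose GG : set (set Config) := fun A => exists n, depends_on (mem (iota 0 n)) A.
apply: (@g_sigma_algebra_measure_unique _ R Config GG _ (fun=> setT)) => //=.
- by move=> B [n Bn]; exact: depends_on_measurable Bn.
- by move=> _; exists 0%N.
- by rewrite bigcup_const //; exists 0%N.
- move=> B B' [n Bn] [n' Bn']; exists (maxn n n') => phi psi h; congr (_ /\ _).
    by apply: Bn => v; rewrite mem_iota0 => vn; apply: h; rewrite mem_iota0 leq_max vn.
  by apply: Bn' => v; rewrite mem_iota0 => vn; apply: h; rewrite mem_iota0 leq_max vn orbT.
- move=> B [n Bn].
  have := @eq_measure_cells R P1 P2 (iota 0 n) setT (iota_uniq _ _) measurableT _ B Bn.
  rewrite !setIT; apply => xi; rewrite !setIT.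
  have e : cell (mem (iota 0 n)) xi = cell (fun v => (v < n)%N) xi.
    by apply: eq_cell => // v; rewrite mem_iota0.
  by rewrite e; apply: etrans (gibbs_cell n xi g1) _; exact/esym/gibbs_cell.
- by move=> _; rewrite ltey_eq fin_num_measure.
- apply: (smallest_sub (smallest_sigma_algebra _ _) _ mA) => B [v [c ->]].
  apply: sub_sigma_algebra; exists v.+1 => phi psi h.
  by rewrite /= h // mem_iota0.
Qed.
End Uniqueness.
End BoundaryWeights.

(** * Fixed points of the recursion on the regular tree *)

Section QNumbers.
Variable R : realType.
Implicit Types (u : R) (n d : nat).

Definition qnum u n : R := \sum_(i < n) u ^+ i.

Lemma qnum0 u : qnum u 0 = 0.
Proof. by rewrite /qnum big_ord0. Qed.

Lemma qnumSr u n : qnum u n.+1 = qnum u n + u ^+ n.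
Proof. by rewrite /qnum big_ord_recr. Qed.

Lemma qnumSl u n : qnum u n.+1 = 1 + u * qnum u n.
Proof.
rewrite /qnum big_ord_recl expr0 mulr_sumr; congr (_ + _).
by apply: eq_bigr => i _; rewrite -exprS.
Qed.

Lemma qnum1E n : qnum 1 n = n%:R.
Proof.
rewrite /qnum (eq_bigr (fun=> 1)) => [|i _]; last by rewrite expr1n.
by rewrite sumr_const card_ord.
Qed.

Lemma qnum_ge0 u n : 0 <= u -> 0 <= qnum u n.
Proof. by move=> u0; apply: sumr_ge0 => i _; exact: exprn_ge0. Qed.

Lemma qnum_gt0 u n : 0 <= u -> 0 < qnum u n.+1.
Proof. by move=> u0; rewrite qnumSl ltr_pwDl // mulr_ge0 // qnum_ge0. Qed.

Lemma qnum_log_concave u n :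
  qnum u n.+2 * qnum u n = qnum u n.+1 ^+ 2 - u ^+ n.
Proof.
have e : u ^+ n = 1 + u * qnum u n - qnum u n.
  by apply/eqP; rewrite eq_sym subr_eq -qnumSl addrC qnumSr.
by rewrite e (qnumSl u n.+1) (qnumSl u n); ring.
Qed.

(** Pair the first and last terms, 1 + s^(2n) >= 2 s^n; the inner terms are s^2 times a shorter sum,
    whence the induction in steps of two. *)
Lemma qnum_AMGM (s : R) n : 0 <= s -> n.+1%:R * s ^+ n <= qnum (s ^+ 2) n.+1.
Proof.
move=> s0; elim/ltn_ind: n => -[|[|n]] IH.
- by rewrite qnumSl qnum0 mulr0 addr0 expr0 mulr1.
- rewrite !qnumSl qnum0 mulr0 addr0 mulr1 expr1.
  by have := sqr_ge0 (s - 1); nra.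
- rewrite qnumSl qnumSr mulrDr.
  have h1 : s ^+ 2 * (n.+1%:R * s ^+ n) <= s ^+ 2 * qnum (s ^+ 2) n.+1.
    by apply: ler_wpM2l (IH n _); rewrite ?exprn_ge0.
  have h2 : 0 <= (s ^+ n.+2 - 1) ^+ 2 by exact: sqr_ge0.
  have e1 : s ^+ 2 * (n.+1%:R * s ^+ n) = n.+1%:R * s ^+ n.+2.
    by rewrite mulrCA -exprD.
  have e2 : s ^+ 2 * (s ^+ 2) ^+ n.+1 = s ^+ n.+2 * s ^+ n.+2.
    by rewrite -exprS -exprM -exprD; congr (_ ^+ _); lia.
  have e3 : n.+3%:R = n.+1%:R + 2 :> R by rewrite -natrD addn2.
  rewrite e3; rewrite expr2 in h2; nra.
Qed.

Lemma qnum_sq_ge u n : 0 <= u -> n.+1%:R ^+ 2 * u ^+ n <= qnum u n.+1 ^+ 2.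
Proof.
move=> u0; have s0 := sqrtr_ge0 u.
have := qnum_AMGM n s0; rewrite sqr_sqrtr // => h.
have -> : u ^+ n = (Num.sqrt u ^+ n) ^+ 2 by rewrite -exprM mulnC exprM sqr_sqrtr.
by rewrite -exprMn ler_sqr // nnegrE ?qnum_ge0 // mulr_ge0 // exprn_ge0.
Qed.

Definition qratio u n : R := (qnum u n.+2 / n.+2%:R) / (qnum u n.+1 / n.+1%:R).

Lemma qratio_gt0 u n : 0 <= u -> 0 < qratio u n.
Proof. by move=> u0; rewrite !divr_gt0 ?qnum_gt0. Qed.

(** The sequence [k] / k is log-convex: passing from the square of the middle term to the product of
    its neighbours subtracts u^(n+1) from [n+2]^2 but 1 from (n+2)^2, and [n+2]^2 >= (n+2)^2
    u^(n+1). *)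
Lemma qratio_ler u n : 0 <= u -> qratio u n <= qratio u n.+1.
Proof.
move=> u0; rewrite /qratio.
have p1 := @qnum_gt0 u n u0; have p2 := @qnum_gt0 u n.+1 u0.
have p3 := @qnum_gt0 u n.+2 u0.
rewrite ler_pdivlMr ?divr_gt0 //.
rewrite mulrAC ler_pdivrMr ?divr_gt0 //.
have e := qnum_log_concave u n.+1; have h := qnum_sq_ge n.+1 u0.
have n1 : 0 < n.+1%:R :> R by [].
have n2 : 0 < n.+2%:R :> R by [].
have n3 : 0 < n.+3%:R :> R by [].
rewrite !mulf_div ler_pdivrMr ?mulr_gt0 // mulrAC ler_pdivlMr ?mulr_gt0 //.
rewrite e -!expr2.
have -> : n.+3%:R * n.+1%:R = n.+2%:R ^+ 2 - 1 :> R.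
  by rewrite -(natr1 n.+2) -(natr1 n.+1); ring.
nra.
Qed.

Lemma qratio_homo u : 0 <= u -> {homo qratio u : m n / (m <= n)%N >-> m <= n}.
Proof.
move=> u0; apply: homo_leq => [x|y x z|n]; [exact: lexx|exact: le_trans|].
exact: qratio_ler.
Qed.

(** The left side telescopes into [k] successive ratios, each at most [qratio u n]. *)
Lemma qnum_le_qratio u n k : 0 <= u -> (k <= n)%N ->
  qnum u k.+1 / k.+1%:R <= qratio u n ^+ k.
Proof.
move=> u0; elim: k => [|k IH] kn; first by rewrite qnumSl qnum0 mulr0 addr0 divr1.
have -> : qnum u k.+2 / k.+2%:R = qratio u k * (qnum u k.+1 / k.+1%:R).
  by rewrite /qratio divfK // mulf_neq0 ?invr_neq0 ?gt_eqF ?qnum_gt0.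
rewrite exprS ler_pM ?divr_ge0 ?qnum_ge0 ?(ltW (qratio_gt0 _ _)) ?IH ?(ltnW kn) //.
exact: qratio_homo (ltnW kn).
Qed.

(* [q_activity d u] is the activity at which the recursion on the tree with
   branching number [d] has a fixed point whose green and red messages have
   ratio [u]. *)
Definition q_activity d u : R := (qnum u d.+1 / qnum u d) ^+ d / (u * qnum u d.-1).

Definition critical_activity d : R := (d.+1%:R / d%:R) ^+ d / d.-1%:R.

Lemma q_activity1 d : q_activity d 1 = critical_activity d.
Proof. by rewrite /q_activity /critical_activity !qnum1E mul1r. Qed.

(** With r the ratio of [d+1] / (d+1) to [d] / d, the claim becomes u [d-1] / (d-1) < r^d. Here
    [d-1] / (d-1) <= r^(d-2), and u < r^2 because r >= (1 + u) / 2. *)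
Lemma critical_activity_lt d u : (2 <= d)%N -> 0 < u -> u != 1 ->
  critical_activity d < q_activity d u.
Proof.
case: d => [|[|d]] // _ u0 u1; have u0' := ltW u0.
rewrite /q_activity /critical_activity /=.
have p1 := qnum_gt0 d u0'; have p2 := qnum_gt0 d.+1 u0'.
have p3 := qnum_gt0 d.+2 u0'.
have e : qnum u d.+3 / qnum u d.+2 = d.+3%:R / d.+2%:R * qratio u d.+1.
  by rewrite /qratio; field; rewrite ?pnatr_eq0 ?gt_eqF.
rewrite e [X in _ < X / _]exprMn -[X in _ < X]mulrA ltr_pM2l ?exprn_gt0 ?divr_gt0 //.
have r0 := qratio_gt0 0 u0'.
have r1 : qratio u 0 <= qratio u d.+1 by exact: qratio_homo.
have hu : u < qratio u 0 ^+ 2.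
  rewrite /qratio !qnumSl qnum0 mulr0 addr0 mulr1 !divr1.
  have : 0 < (u - 1) ^+ 2 by rewrite exprn_even_gt0 //= subr_eq0.
  by rewrite !expr2; nra.
have hu2 : u < qratio u d.+1 ^+ 2.
  apply: lt_le_trans hu _; rewrite ler_sqr // nnegrE ltW //.
  exact: qratio_gt0.
rewrite ltr_pdivlMr ?mulr_gt0 //.
apply: (@lt_le_trans _ _ (qnum u d.+1 / d.+1%:R * qratio u d.+1 ^+ 2)).
  rewrite (_ : _ * (u * _) = qnum u d.+1 / d.+1%:R * u); last by ring.
  by rewrite ltr_pM2l // divr_gt0.
by rewrite -[d.+2]addn2 exprD ler_wpM2r ?sqr_ge0 // qnum_le_qratio.
Qed.
End QNumbers.

(** * Symmetric and asymmetric fixed points *)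

Section FixedPoints.
Variable R : realType.
Implicit Types (L x z u : R) (d : nat).

(* The recursion for the weights [x] (green) and [z] (red), relative to yellow,
   at the root of a subtree; the two components are exchanged by symmetry. *)
Definition tree_step L d x z : R := L * ((1 + x) / (1 + x + z)) ^+ d.

Lemma tree_fixpoint_eq L d x z : (2 <= d)%N -> 0 < L -> L <= critical_activity R d ->
  0 < z -> z <= x -> x = tree_step L d x z -> z = tree_step L d z x -> x = z.
Proof.
case: d => [|[|d]] // _ L0 Lc z0 zx ex ez.
apply/eqP; rewrite eq_le zx andbT leNgt; apply/negP => zltx.
have x0 : 0 < x by exact: lt_le_trans zx.
have s0 : 0 < 1 + x + z by lra.
pose u := (1 + x) / (1 + z).
have u1 : 1 < u by rewrite /u ltr_pdivlMr; lra.
have u0 : 0 < u by lra.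
have eu : x = u ^+ d.+2 * z.
  rewrite [in RHS]ez [in LHS]ex /tree_step (addrAC 1 z x) [RHS]mulrCA -exprMn; congr (_ * _ ^+ _).
  by rewrite /u; field; lra.
have e1 : 1 + x = u + u * z by rewrite /u; field; lra.
have p1 := qnum_gt0 d (ltW u0); have p2 := qnum_gt0 d.+1 (ltW u0).
have p3 := qnum_gt0 d.+2 (ltW u0).
have q1 : qnum u d.+2 = 1 + u * qnum u d.+1 by rewrite qnumSl.
have q2 : qnum u d.+3 = 1 + u * qnum u d.+2 by rewrite qnumSl.
have q3 : u ^+ d.+2 = qnum u d.+3 - qnum u d.+2.
  by rewrite [qnum u d.+3]qnumSr addrAC subrr add0r.
(* Put x = u^(d+2) z into 1 + x = u (1 + z) and divide by u - 1, which is nonzero. *)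
have ezz : z * (u * qnum u d.+1) = 1.
  have h : (u - 1) * (z * (u * qnum u d.+1) - 1) = 0.
    have : 1 + u ^+ d.+2 * z = u + u * z by rewrite -eu.
    move=> /eqP; rewrite q3 q2 q1 -subr_eq0 => /eqP h.
    by rewrite -[RHS]h; ring.
  by move/eqP: h; rewrite mulf_eq0 !subr_eq0 gt_eqF //= => /eqP.
have hz : z = (u * qnum u d.+1)^-1.
  by rewrite -[RHS]mul1r -ezz mulfK // mulf_neq0 ?gt_eqF.
have eB : (1 + z) / (1 + z + x) = qnum u d.+2 / qnum u d.+3.
  have w : z * (qnum u d.+2 - 1) = 1 by rewrite q1 addrC addKr.
  have e2 : (1 + z) * qnum u d.+3 = qnum u d.+2 * (1 + z + x).
    rewrite eu q3 q2; set D := qnum u d.+2 in w *.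
    have -> : 1 + z = z * D by rewrite -w; ring.
    by ring.
  have s0' : 0 < 1 + z + x by lra.
  by apply/eqP; rewrite eqr_div; [rewrite e2|exact: lt0r_neq0..].
have eL : L = q_activity d.+2 u.
  rewrite /q_activity /= -hz ez /tree_step eB mulrC -mulrA -exprMn mulf_div.
  by rewrite [X in _ / X]mulrC divff ?expr1n ?mulr1 // mulf_neq0 ?gt_eqF.
have := @critical_activity_lt R d.+2 u isT u0 _.
by rewrite gt_eqF // -eL ltNge Lc => /(_ isT).
Qed.

Lemma qnum_continuous n : continuous (fun u => qnum u n).
Proof.
move=> u; elim: n => [|n IH].
  have -> : (fun v : R => qnum v 0) = cst 0 by apply/funext => v; exact: qnum0.
  exact: cst_continuous.
have -> : (fun v : R => qnum v n.+1) = (fun v => qnum v n + v ^+ n).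
  by apply/funext => v; rewrite qnumSr.
apply: cvgD; first exact: IH.
exact: exprn_continuous.
Qed.

Lemma q_activity_onto L d : (2 <= d)%N -> critical_activity R d < L ->
  exists2 u, 1 < u & q_activity d u = L.
Proof.
case: d => [|[|d]] // _ Lc.
have Lc0 : 0 < critical_activity R d.+2 by rewrite divr_gt0 // exprn_gt0 // divr_gt0.
(* Since [d+3] >= K [d+2] and [d+1] <= (d+1) K^d at u = K, the activity there is at least K / (d+1),
   which exceeds L. *)
pose K := 1 + d.+1%:R * L.
have K1 : 1 <= K by rewrite /K lerDl mulr_ge0 // ltW // (lt_trans Lc0).
have K0 : 0 < K by lra.
have hK : L <= q_activity d.+2 K.
  rewrite /q_activity /=.
  have p1 := qnum_gt0 d (ltW K0); have p2 := qnum_gt0 d.+1 (ltW K0).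
  have a1 : K <= qnum K d.+3 / qnum K d.+2.
    by rewrite ler_pdivlMr // [leRHS]qnumSl lerDr.
  have a2 : K ^+ d.+2 <= (qnum K d.+3 / qnum K d.+2) ^+ d.+2.
    by rewrite lerXn2r // nnegrE ?ltW // divr_gt0 // qnum_gt0 // ltW.
  have a3 : qnum K d.+1 <= d.+1%:R * K ^+ d.
    rewrite /qnum; apply: le_trans (_ : \sum_(i < d.+1) K ^+ d <= _).
      by apply: ler_sum => i _; rewrite ler_weXn2l // -ltnS.
    by rewrite sumr_const card_ord mulr_natl.
  rewrite ler_pdivlMr ?mulr_gt0 //; apply: le_trans a2.
  apply: le_trans (_ : L * (K * (d.+1%:R * K ^+ d)) <= _).
    by rewrite ler_pM2l ?(lt_trans Lc0 Lc) // ler_pM2l.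
  have -> : L * (K * (d.+1%:R * K ^+ d)) = (d.+1%:R * L) * K ^+ d.+1.
    by rewrite exprS; ring.
  rewrite [K ^+ d.+2]exprS ler_wpM2r ?exprn_ge0 ?ltW //.
  by rewrite /K ltrDr.
have hc : {within `[1, K], continuous (q_activity d.+2)}%classic.
  apply: continuous_in_subspaceT => x; rewrite inE /= in_itv /= => /andP[x1 _].
  have x0 : 0 < x by lra.
  rewrite /q_activity /=; apply: cvgM.
    apply: (@cvg_comp _ _ _ _ (fun y : R => y ^+ d.+2)).
      apply: cvgM; [exact: qnum_continuous|apply: cvgV; last exact: qnum_continuous].
      by rewrite gt_eqF // qnum_gt0 // ltW.
    exact: exprn_continuous.
  apply: cvgV; first by rewrite gt_eqF // mulr_gt0 // qnum_gt0 // ltW.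
  by apply: cvgM; [exact: cvg_id|exact: qnum_continuous].
have [|u] := @IVT R (q_activity d.+2) 1 K L K1 hc.
  by rewrite ge_min le_max q_activity1 hK (ltW Lc) orbT.
rewrite in_itv /= => /andP[u1 _] eu; exists u => //.
rewrite lt_neqAle u1 andbT; apply/eqP => e.
by move: Lc; rewrite -eu -e q_activity1 ltxx.
Qed.

Lemma tree_fixpoint_asym L d : (2 <= d)%N -> critical_activity R d < L ->
  exists x z, [/\ 0 < z, z < x, x = tree_step L d x z & z = tree_step L d z x].
Proof.
case: d => [|[|d]] // _ Lc.
have [u u1 eL] := @q_activity_onto L d.+2 isT Lc.
have u0 : 0 < u by lra.
have p1 := qnum_gt0 d (ltW u0); have p2 := qnum_gt0 d.+1 (ltW u0).
have p3 := qnum_gt0 d.+2 (ltW u0).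
have q1 : qnum u d.+2 = 1 + u * qnum u d.+1 by rewrite qnumSl.
have q2 : qnum u d.+3 = 1 + u * qnum u d.+2 by rewrite qnumSl.
have q3 : u ^+ d.+2 = qnum u d.+3 - qnum u d.+2.
  by rewrite [qnum u d.+3]qnumSr addrAC subrr add0r.
have up : 0 < u * qnum u d.+1 by rewrite mulr_gt0.
(* These are the values forced on an asymmetric fixed point in [tree_fixpoint_eq]. *)
exists (u ^+ d.+2 / (u * qnum u d.+1)), (u * qnum u d.+1)^-1.
have zz : (1 + (u * qnum u d.+1)^-1) / (1 + (u * qnum u d.+1)^-1 +
    u ^+ d.+2 / (u * qnum u d.+1)) = qnum u d.+2 / qnum u d.+3.
  have g : u * qnum u d.+1 + 1 + u ^+ d.+2 = qnum u d.+3 by rewrite q3 q1; ring.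
  have g' : u * qnum u d.+1 + 1 = qnum u d.+2 by rewrite q1; ring.
  by rewrite -g -g'; field; rewrite ?g ?gt_eqF.
have xx : (1 + u ^+ d.+2 / (u * qnum u d.+1)) / (1 + u ^+ d.+2 / (u * qnum u d.+1) +
    (u * qnum u d.+1)^-1) = u * (qnum u d.+2 / qnum u d.+3).
  have g : u * qnum u d.+1 + u ^+ d.+2 + 1 = qnum u d.+3 by rewrite q3 q1; ring.
  have g' : u * qnum u d.+1 + u ^+ d.+2 = u * qnum u d.+2 by rewrite q3 q2 q1; ring.
  by rewrite -g mulrA -g'; field; rewrite ?g ?gt_eqF.
have LL : L * (qnum u d.+2 / qnum u d.+3) ^+ d.+2 = (u * qnum u d.+1)^-1.
  rewrite -eL /q_activity /= mulrAC -exprMn mulf_div [qnum u d.+3 * _]mulrC.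
  by rewrite divff ?expr1n ?mul1r // mulf_neq0 ?gt_eqF.
split.
- by rewrite invr_gt0.
- by rewrite ltr_pMl ?invr_gt0 // exprn_egt1.
- by rewrite /tree_step xx exprMn mulrCA LL.
- by rewrite /tree_step zz LL.
Qed.
End FixedPoints.

(** * The effective activity *)

Section EffectiveActivity.
Variable R : realType.
Implicit Types (l : R) (m : nat).

(** A pendant leaf contributes 1 + l to a green or red node and 1 + 2 l to a yellow one. *)
Definition leaf_factor l : R := (1 + l) / (1 + 2 * l).

Definition eff_activity m l : R := l * leaf_factor l ^+ m.

Lemma leaf_factor_gt0 l : 0 <= l -> 0 < leaf_factor l.
Proof. by move=> l0; rewrite /leaf_factor divr_gt0; lra. Qed.

Lemma eff_activity_gt0 m l : 0 < l -> 0 < eff_activity m l.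
Proof. by move=> l0; rewrite mulr_gt0 // exprn_gt0 // leaf_factor_gt0 // ltW. Qed.

(** Written so that the sign is that of the quadratic (1 + l) (1 + 2 l) - m l. *)
Lemma eff_activity_is_derive m l : 0 <= l ->
  is_derive l (1 : R) (eff_activity m)
    (leaf_factor l ^+ m * ((1 + l) * (1 + 2 * l) - m%:R * l) / ((1 + l) * (1 + 2 * l))).
Proof.
move=> l0.
have h2 : 1 + 2 * l != 0 by rewrite gt_eqF //; lra.
have h1 : 1 + l != 0 by rewrite gt_eqF //; lra.
have dn : is_derive l (1 : R) (fun x : R => 1 + x) 1.
  by apply: is_derive_eq; rewrite add0r mulr1.
have dd : is_derive l (1 : R) (fun x : R => 1 + 2 * x) 2.
  by apply: is_derive_eq; rewrite /GRing.scale /=; ring.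
have di := @is_deriveV R (fun x => 1 + 2 * x) l _ _ h2 dd.
have ds : is_derive l (1 : R) leaf_factor (- (1 + 2 * l) ^- 2).
  have := @is_deriveM _ _ _ _ _ _ _ _ dn di; rewrite /GRing.scale /=.
  by congr is_derive; field.
have dx := @is_deriveX _ _ _ m _ _ _ ds.
have := @is_deriveM _ _ _ _ _ _ _ _ (is_derive_id l (1 : R)) dx.
rewrite /GRing.scale /= exprfctE => h.
rewrite (_ : _ / _ = l * (m%:R * leaf_factor l ^+ m.-1 * - (1 + 2 * l) ^- 2) +
  leaf_factor l ^+ m * 1) //.
case: m {h dx} => [|m] /=.
  by rewrite !expr0 !mul0r subr0; field; rewrite h1 h2.
rewrite [leaf_factor l ^+ m.+1]exprS /leaf_factor.
set t := ((1 + l) / _) ^+ m.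
by field; rewrite h1 h2.
Qed.

Lemma eff_activity_continuous m l : 0 <= l -> {for l, continuous (eff_activity m)}.
Proof.
move=> l0; have [df _] := eff_activity_is_derive m l0.
exact/differentiable_continuous/derivable1_diffP.
Qed.

Lemma eff_activity_within m (a b : R) : 0 <= a ->
  {within `[a, b], continuous (eff_activity m)}%classic.
Proof.
move=> a0; apply: continuous_in_subspaceT => x; rewrite inE /= in_itv /= => /andP[ax _].
by apply: eff_activity_continuous; exact: le_trans ax.
Qed.

Lemma eff_activity_incr m (a b : R) : 0 <= a ->
  (forall x, a < x < b -> m%:R * x < (1 + x) * (1 + 2 * x)) ->
  forall x y, a <= x -> x < y -> y <= b -> eff_activity m x < eff_activity m y.
Proof.
move=> a0 h x y ax xy yb.
apply: (@gtr0_derive1_lt_cc _ (eff_activity m) a b) => //;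
  rewrite ?in_itv /= ?ax ?yb ?(le_trans ax (ltW xy)) ?(le_trans (ltW xy) yb) //.
- move=> z; rewrite in_itv /= => /andP[az _].
  by have [] := eff_activity_is_derive m (le_trans a0 (ltW az)).
- move=> z; rewrite in_itv /= => zab; have /andP[az zb] := zab.
  have z0 : 0 <= z by exact: le_trans (ltW az).
  have [_ e] := eff_activity_is_derive m z0; rewrite derive1E e.
  rewrite divr_gt0 // ?mulr_gt0 ?exprn_gt0 ?leaf_factor_gt0 ?subr_gt0 ?h //; lra.
- exact: eff_activity_within.
Qed.

Lemma eff_activity_decr m (a b : R) : 0 <= a ->
  (forall x, a < x < b -> (1 + x) * (1 + 2 * x) < m%:R * x) ->
  forall x y, a <= x -> x < y -> y <= b -> eff_activity m y < eff_activity m x.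
Proof.
move=> a0 h x y ax xy yb.
apply: (@ltr0_derive1_lt_cc _ (eff_activity m) a b) => //;
  rewrite ?in_itv /= ?ax ?yb ?(le_trans ax (ltW xy)) ?(le_trans (ltW xy) yb) //.
- move=> z; rewrite in_itv /= => /andP[az _].
  by have [] := eff_activity_is_derive m (le_trans a0 (ltW az)).
- move=> z; rewrite in_itv /= => zab; have /andP[az zb] := zab.
  have z0 : 0 <= z by exact: le_trans (ltW az).
  have [_ e] := eff_activity_is_derive m z0; rewrite derive1E e.
  rewrite pmulr_llt0 ?invr_gt0 ?mulr_gt0 // ?pmulr_rlt0 ?exprn_gt0 ?leaf_factor_gt0 ?subr_lt0 ?h //; lra.
- exact: eff_activity_within.
Qed.

Lemma eff_activity_solve m (a b L : R) : 0 <= a -> a <= b ->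
  Num.min (eff_activity m a) (eff_activity m b) <= L <=
    Num.max (eff_activity m a) (eff_activity m b) ->
  exists2 l, a <= l <= b & eff_activity m l = L.
Proof.
move=> a0 ab h; have [l] := IVT ab (@eff_activity_within m a b a0) h.
by rewrite in_itv /= => ? ?; exists l.
Qed.

Lemma leaf_factor_decr (x y : R) : 0 <= x -> x <= y -> leaf_factor y <= leaf_factor x.
Proof.
move=> x0 xy; rewrite /leaf_factor ler_pdivrMr; last by lra.
by rewrite mulrAC ler_pdivlMr; lra || nra.
Qed.

(* With 12 pendant leaves the effective activity increases on [(0, 1/10]],
   decreases on [[1/8, 4]] and increases on [[5, oo)], while on the two gaps it
   stays on a fixed side of the level. *)
Lemma eff_activity12_crossings (L : R) : 1 / 160 <= L <= 1 / 36 ->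
  exists a b c : R, [/\ 0 < a, a < b & b < c] /\
   (forall l, 0 < l -> l <= a \/ b <= l <= c -> eff_activity 12 l <= L) /\
   (forall l, a < l < b \/ c < l -> L < eff_activity 12 l).
Proof.
move=> /andP[L1 L2].
pose f := eff_activity 12.
have inc1 : forall x y, 0 <= x -> x < y -> y <= 1 / 10 -> f x < f y.
  by apply: eff_activity_incr => // x /andP[? ?]; nra.
have dec : forall x y, 1 / 8 <= x -> x < y -> y <= 4 -> f y < f x.
  by apply: eff_activity_decr; [lra|move=> x /andP[? ?]; nra].
have inc2 : forall x y, 5 <= x -> x < y -> f x < f y.
  move=> x y x5 xy; apply: (@eff_activity_incr 12 5 y) => //.
  by move=> z /andP[? ?]; nra.
(* The value of [leaf_factor] at 1/8 is 9/10, and (1/10) (9/10)^12 > 1/36. *)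
have gap1 l : 1 / 10 <= l <= 1 / 8 -> L < f l.
  move=> /andP[l1 l2]; apply: (le_lt_trans L2); rewrite /f /eff_activity.
  have g1 : 9 / 10 <= leaf_factor l.
    apply: le_trans (leaf_factor_decr _ l2); last by lra.
    by rewrite /leaf_factor ler_pdivlMr; lra.
  have g2 : (9 / 10) ^+ 12 <= leaf_factor l ^+ 12 by apply: lerXn2r => //; rewrite nnegrE; lra.
  apply: (@lt_le_trans _ _ (1 / 10 * (9 / 10) ^+ 12)); first by lra.
  by apply: ler_pM => //; apply: exprn_ge0; lra.
(* The value of [leaf_factor] at 4 is 5/9, and 5 (5/9)^12 < 1/160. *)
have gap2 l : 4 <= l <= 5 -> f l < L.
  move=> /andP[l1 l2]; apply: (lt_le_trans _ L1); rewrite /f /eff_activity.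
  have g1 : leaf_factor l <= 5 / 9.
    apply: (le_trans (leaf_factor_decr _ l1)); first by lra.
    by rewrite /leaf_factor ler_pdivrMr; lra.
  have g0 : 0 < leaf_factor l by apply: leaf_factor_gt0; lra.
  have g2 : leaf_factor l ^+ 12 <= (5 / 9) ^+ 12 by apply: lerXn2r => //; rewrite nnegrE; lra.
  apply: (@le_lt_trans _ _ (5 * (5 / 9) ^+ 12)); last by lra.
  by apply: ler_pM => //; (lra || (apply: exprn_ge0; lra)).
(* As [leaf_factor] is at least 1/2, the value at 128 is at least 128 / 2^12 = 1/32 > 1/36. *)
have big : L < f 128.
  rewrite /f /eff_activity; have g1 : 1 / 2 <= leaf_factor (128 : R).
    by rewrite /leaf_factor ler_pdivlMr; lra.
  have g2 : (1 / 2) ^+ 12 <= leaf_factor (128 : R) ^+ 12 by apply: lerXn2r => //; rewrite nnegrE; lra.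
  by apply: (@lt_le_trans _ _ (128 * (1 / 2) ^+ 12)); [lra|rewrite ler_pM2l].
have f0 : f 0 = 0 by rewrite /f /eff_activity mul0r.
have f10 : L < f (1 / 10) by apply: gap1; lra.
have f8 : L < f (1 / 8) by apply: gap1; lra.
have f4 : f 4 < L by apply: gap2; lra.
have f5 : f 5 < L by apply: gap2; lra.
have [a /andP[a0 a1] fa] : exists2 l, 0 <= l <= 1 / 10 & f l = L.
  by apply: eff_activity_solve; rewrite ?ge_min ?le_max -/f ?f0; lra.
have [b /andP[b0 b1] fb] : exists2 l, 1 / 8 <= l <= 4 & f l = L.
  by apply: eff_activity_solve; rewrite ?ge_min ?le_max -/f ?(ltW f8) ?(ltW f4) ?orbT //; lra.
have [c /andP[c0 c1] fc] : exists2 l, 5 <= l <= 128 & f l = L.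
  by apply: eff_activity_solve; rewrite ?ge_min ?le_max -/f ?(ltW big) ?(ltW f5) ?orbT //; lra.
have a00 : 0 < a.
  by rewrite lt_neqAle a0 andbT; apply/eqP => e; move: fa; rewrite -e f0; lra.
have ab : a < b by lra.
have bc : b < c by lra.
exists a, b, c; split; first by [].
split=> l.
  move=> l0 [la|/andP[bl lc]]; rewrite -/(f l).
    by rewrite -fa; move: la; rewrite le_eqVlt => /orP[/eqP->//|la]; exact/ltW/inc1/a1/la/ltW.
  have [l4|l4] := leP l 4.
    by rewrite -fb; move: bl; rewrite le_eqVlt => /orP[/eqP->//|bl]; exact/ltW/dec.
  have [l5|l5] := leP l 5; first by apply/ltW/gap2; rewrite (ltW l4).
  by rewrite -fc; move: lc; rewrite le_eqVlt => /orP[/eqP->//|lc]; exact/ltW/inc2/lc/ltW.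
move=> [/andP[al lb]|cl]; rewrite -/(f l); last by rewrite -fc; exact: inc2.
have [l1|l1] := leP l (1 / 10); first by rewrite -fa; exact: inc1.
have [l8|l8] := leP l (1 / 8); first by apply: gap1; rewrite (ltW l1).
by rewrite -fb; exact/dec/b1/lb/ltW.
Qed.

Lemma critical_activity160 : 1 / 160 <= critical_activity R 160 <= 1 / 36.
Proof.
rewrite /critical_activity (_ : 160.-1 = 159)%N //.
set q : R := 161%:R / 160%:R.
have q1 : 1 <= q by rewrite /q ler_pdivlMr; lra.
have bern n : 1 - n%:R / 161 <= q^-1 ^+ n.
  elim: n => [|n IH]; first by rewrite mul0r subr0 expr0.
  have qi : q^-1 = 160 / 161 by rewrite /q; field.
  have n0 : 0 <= n%:R :> R by [].
  rewrite exprS; apply: (@le_trans _ _ (q^-1 * (1 - n%:R / 161))).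
    by rewrite qi -natr1; lra.
  by rewrite ler_pM2l // invr_gt0; lra.
(* Bernoulli at exponent 160 would only give q^160 <= 161; at exponent 80, followed by squaring, it
   gives (161/81)^2 < 159/36. *)
have h80 : q ^+ 80 <= 161 / 81.
  have := bern 80; rewrite exprVn => h.
  have q80 : 0 < q ^+ 80 by apply: exprn_gt0; lra.
  have : q ^+ 80 * (1 - 80%:R / 161) <= q ^+ 80 * q ^- 80 by rewrite ler_pM2l.
  by rewrite divff ?gt_eqF //; lra.
have q160 : q ^+ 160 = q ^+ 80 * q ^+ 80 by rewrite -exprD.
have l160 : 1 <= q ^+ 80 by rewrite exprn_ege1.
rewrite q160; set t := q ^+ 80 in h80 l160 *.
by rewrite ler_pdivlMr // ler_pdivrMr //; apply/andP; split; nra.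
Qed.
End EffectiveActivity.

(** * The decorated tree *)

Lemma neq_yellow c : c != Yellow -> c = Green \/ c = Red.
Proof. by case: c; rewrite ?eqxx //; [left|right]. Qed.

(** * Iterating the recursion from the extreme weights *)

Section TreeIteration.
Variables (R : realType) (L : R) (d : nat).
Hypothesis L_gt0 : 0 < L.

Lemma tree_ratio_mono (x z a b : R) : 0 <= z -> z <= a <= x -> z <= b <= x ->
  (1 + z) / (1 + z + x) <= (1 + a) / (1 + a + b) <= (1 + x) / (1 + x + z).
Proof.
move=> z0 /andP[za ax] /andP[zb bx].
have key (p q r s : R) : 0 <= p -> 0 <= q -> 0 <= r -> 0 <= s -> p <= r -> s <= q ->
    (1 + p) / (1 + p + q) <= (1 + r) / (1 + r + s).
  move=> p0 q0 r0 s0 pr sq; rewrite ler_pdivrMr; last by lra.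
  rewrite mulrAC ler_pdivlMr; last by lra.
  have h : (1 + p) * s <= (1 + r) * q by apply: ler_pM; lra.
  rewrite -subr_ge0 (_ : _ - _ = (1 + r) * q - (1 + p) * s); last by ring.
  by rewrite subr_ge0.
by apply/andP; split; apply: key; lra.
Qed.

(* The best bounds on the relative weights of red and green at a vertex that is
   at distance at least [k] from the boundary. *)
Fixpoint tree_iter k : R * R :=
  if k is k'.+1 then
    (tree_step L d (tree_iter k').1 (tree_iter k').2,
     tree_step L d (tree_iter k').2 (tree_iter k').1)
  else (L, 0).

Local Notation X k := (tree_iter k).1.
Local Notation Z k := (tree_iter k).2.

Lemma tree_step_mono (x z a b : R) : 0 <= z -> z <= a <= x -> z <= b <= x ->
  tree_step L d z x <= tree_step L d a b <= tree_step L d x z.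
Proof.
move=> z0 ha hb; have /andP[h1 h2] := tree_ratio_mono z0 ha hb.
move: ha hb => /andP[? ?] /andP[? ?].
have p1 : 0 <= (1 + z) / (1 + z + x) by rewrite divr_ge0; lra.
by rewrite /tree_step !ler_pM2l // !lerXn2r // nnegrE; lra.
Qed.

Lemma tree_step_bounds (x z : R) : 0 <= x -> 0 <= z -> 0 <= tree_step L d x z <= L.
Proof.
move=> x0 z0; rewrite /tree_step.
have h0 : 0 <= (1 + x) / (1 + x + z) by rewrite divr_ge0; lra.
have h1 : (1 + x) / (1 + x + z) <= 1 by rewrite ler_pdivrMr; lra.
by rewrite mulr_ge0 ?exprn_ge0 ?(ltW L_gt0) // ler_piMr ?exprn_ile1 // ltW.
Qed.

Lemma tree_iter_mono k : [/\ 0 <= Z k, Z k <= Z k.+1, Z k.+1 <= X k.+1 & X k.+1 <= X k].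
Proof.
elim: k => [|k [z0 zz zx xx]].
  have L0 := ltW L_gt0.
  have /andP[? ?] := tree_step_bounds L0 (lexx 0).
  have /andP[? ?] := tree_step_bounds (lexx 0) L0.
  have h : 0 <= L <= L by rewrite L0 lexx.
  have h' : 0 <= (0 : R) <= L by rewrite L0 lexx.
  by have /andP[? _] := tree_step_mono (lexx 0) h h'; split.
have z1 : 0 <= Z k.+1 by lra.
have hX : Z k <= X k.+1 <= X k by apply/andP; split; lra.
have hZ : Z k <= Z k.+1 <= X k by apply/andP; split; lra.
have /andP[_ h1] := tree_step_mono z0 hX hZ.
have /andP[h2 _] := tree_step_mono z0 hZ hX.
have hX' : Z k.+1 <= X k.+1 <= X k.+1 by apply/andP; split; lra.
have hZ' : Z k.+1 <= Z k.+1 <= X k.+1 by apply/andP; split; lra.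
by have /andP[h3 _] := tree_step_mono z1 hX' hZ'; split.
Qed.

Lemma tree_step_cvg (x z : nat -> R) (a b : R) : 0 <= a -> 0 <= b ->
  (x k @[k --> \oo] --> a)%classic -> (z k @[k --> \oo] --> b)%classic ->
  (tree_step L d (x k) (z k) @[k --> \oo] --> tree_step L d a b)%classic.
Proof.
move=> a0 b0 xa zb; rewrite /tree_step; apply: cvgM; first exact: cvg_cst.
apply: (@cvg_comp _ _ _ (fun k => (1 + x k) / (1 + x k + z k)) (fun y : R => y ^+ d));
  last exact: exprn_continuous.
have x1 : (1 + x k @[k --> \oo] --> 1 + a)%classic by apply: cvgD => //; exact: cvg_cst.
apply: cvgM => //; apply: cvgV; first by rewrite gt_eqF //; lra.
by apply: cvgD.
Qed.

(** The intervals between the two components are nested, so their endpoints converge; the limits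
    form a fixed point, which [tree_fixpoint_eq] forces to be symmetric. *)
Lemma tree_iter_cvg : (2 <= d)%N -> L <= critical_activity R d ->
  exists x, [/\ 0 < x, x = tree_step L d x x,
    (X k @[k --> \oo] --> x)%classic & (Z k @[k --> \oo] --> x)%classic].
Proof.
move=> d2 Lc.
have Xd : nonincreasing_seq (fun k => X k).
  by apply/nonincreasing_seqP => k; have [] := tree_iter_mono k.
have Zi : nondecreasing_seq (fun k => Z k).
  by apply/nondecreasing_seqP => k; have [] := tree_iter_mono k.
have ZX k : Z k <= X k.
  by case: k => [|k]; [exact: ltW|have [] := tree_iter_mono k].
have Z0 k : 0 <= Z k by have [] := tree_iter_mono k.
have cX : cvgn (fun k => X k).
  apply: nonincreasing_is_cvgn => //; exists 0 => _ [k _ <-]; exact: le_trans (ZX k).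
have cZ : cvgn (fun k => Z k).
  apply: nondecreasing_is_cvgn => //; exists L => _ [k _ <-]; apply: le_trans (ZX k) _.
  by have := Xd 0%N k isT.
set x := limn (fun k => X k) in cX; set z := limn (fun k => Z k) in cZ.
have z_gt0 : 0 < z.
  apply: (@lt_le_trans _ _ (Z 1)); last exact: (nondecreasing_cvgn_le Zi cZ 1%N).
  by rewrite /= /tree_step !addr0 mulr_gt0 // exprn_gt0 // divr_gt0 // addr_gt0.
have zx : z <= x by apply: ler_lim => //; exact: nearW.
have x_gt0 : 0 < x by exact: lt_le_trans zx.
have ex : x = tree_step L d x z.
  apply: (@cvg_unique _ (@Rhausdorff R) (X k.+1 @[k --> \oo])%classic).
    by have := cX; rewrite -(cvg_shiftS (fun k => X k)).
  by apply: tree_step_cvg => //; exact: ltW.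
have ez : z = tree_step L d z x.
  apply: (@cvg_unique _ (@Rhausdorff R) (Z k.+1 @[k --> \oo])%classic).
    by have := cZ; rewrite -(cvg_shiftS (fun k => Z k)).
  by apply: tree_step_cvg => //; exact: ltW.
have exz : x = z by exact: (tree_fixpoint_eq d2 L_gt0 Lc).
by exists x; split=> //; [rewrite {3}exz|rewrite exz].
Qed.
End TreeIteration.

(** * The tree with pendant leaves and its Gibbs measures *)

Section DecoratedTree.
Variables (d m : nat).
Hypothesis d_gt0 : (0 < d)%N.

(* Vertex [m.+1 * i] is the node [i] of the [d]-ary tree in breadth-first
   order; the vertices [m.+1 * i + j] with [0 < j <= m] are the leaves hanging
   from it. *)
Definition dec_par v : nat :=
  if (m.+1 %| v)%N then (m.+1 * ((v %/ m.+1).-1 %/ d))%N else (m.+1 * (v %/ m.+1))%N.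

Definition dec_ch v : seq nat :=
  if (m.+1 %| v)%N then
    [seq (v + j.+1)%N | j <- iota 0 m] ++
    [seq (m.+1 * (d * (v %/ m.+1) + k.+1))%N | k <- iota 0 d]
  else [::].

Lemma dec_par_lt v : (0 < v)%N -> (dec_par v < v)%N.
Proof.
rewrite /dec_par; case: ifP => [/dvdnP[i ->]|nv] v0.
  rewrite mulnK // mulnC ltn_pmul2r //; case: i v0 => [|i] _ //=.
  by rewrite ltnS leq_div.
rewrite mulnC; have := divn_eq v m.+1; move: nv; rewrite /dvdn; lia.
Qed.

Lemma leaf_divn i j : (j < m)%N -> ((m.+1 * i + j.+1) %/ m.+1 = i)%N.
Proof. by move=> jm; rewrite mulnC divnMDl // divn_small ?addn0. Qed.

Lemma leaf_ndvd i j : (j < m)%N -> (m.+1 %| m.+1 * i + j.+1)%N = false.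
Proof. by move=> jm; rewrite dvdn_addr ?dvdn_mulr // gtnNdvd. Qed.

Lemma mem_dec_ch u v : (u \in dec_ch v) = (0 < u)%N && (dec_par u == v).
Proof.
rewrite /dec_ch /dec_par; case: (boolP (m.+1 %| v)%N) => [/dvdnP[i ->]|nv]; last first.
  rewrite in_nil; apply/esym/negP => /andP[_ /eqP e]; move: nv; rewrite -e.
  by case: ifP => _; rewrite dvdn_mulr.
rewrite mulnK // mem_cat; apply/orP/andP => [[/mapP[j]|/mapP[k]]|].
- rewrite mem_iota add0n => jm ->; rewrite (mulnC i) leaf_ndvd // leaf_divn //.
  by rewrite addnS.
- rewrite mem_iota add0n => kd ->; rewrite dvdn_mulr // mulKn // muln_gt0 addnS /= mulnC.
  by split=> //; rewrite divnMDl // divn_small // addn0 mulnC.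
case: (boolP (m.+1 %| u)%N) => [/dvdnP[j ->]|nu] [u0 /eqP].
  rewrite mulnK // mulnC => /eqP; rewrite eqn_pmul2r // => /eqP e; right; apply/mapP.
  case: j u0 e => [|j] //= _ e; exists (j %% d)%N; first by rewrite mem_iota /= ltn_mod.
  by rewrite addnS -e (mulnC d) -divn_eq mulnC.
rewrite mulnC => /eqP; rewrite eqn_pmul2r // => /eqP e; left; apply/mapP.
have := divn_eq u m.+1; rewrite e; move: nu; rewrite /dvdn -lt0n => nu eu.
exists (u %% m.+1).-1; last by rewrite prednK.
by rewrite mem_iota add0n /=; have := ltn_pmod u (ltn0Sn m); lia.
Qed.

Lemma dec_ch_uniq v : uniq (dec_ch v).
Proof.
rewrite /dec_ch; case: ifP => // /dvdnP[i ->]; rewrite cat_uniq !map_inj_uniq ?iota_uniq /=.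
- rewrite andbT; apply/hasPn => _ /mapP[k _ ->]; apply/negP => /mapP[j].
  rewrite mem_iota add0n => jm /(congr1 (dvdn m.+1)).
  by rewrite dvdn_mulr // mulnC leaf_ndvd.
- by move=> a b /eqP; rewrite eqn_pmul2l // eqn_add2l => /eqP[].
- by move=> a b /addnI[].
Qed.

Definition dec_tree := Tree dec_par_lt mem_dec_ch dec_ch_uniq.

Lemma prod_dec_ch (R : comPzRingType) (f : nat -> R) i :
  \prod_(u <- ch dec_tree (m.+1 * i)) f u =
  (\prod_(j < m) f (m.+1 * i + j.+1)%N) * \prod_(k < d) f (m.+1 * (d * i + k.+1))%N.
Proof.
rewrite /= /dec_ch dvdn_mulr // mulKn // big_cat !big_map /=; congr (_ * _).
  by rewrite -(big_mkord xpredT (fun j => f (m.+1 * i + j.+1)%N)) /index_iota subn0.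
by rewrite -(big_mkord xpredT (fun k => f (m.+1 * (d * i + k.+1))%N)) /index_iota subn0.
Qed.

Variable R : realType.
Implicit Types (l x z : R).

Definition dec_weight l x z v (c : color) : R :=
  if (m.+1 %| v)%N then match c with Green => x | Yellow => 1 | Red => z end
  else wr_activity l c.

(** At a node, the unnormalised weight of yellow: [m] leaves and [d] subtrees, all unconstrained. *)
Definition dec_scale l x z v : R :=
  if (m.+1 %| v)%N then (1 + 2 * l) ^+ m * (1 + x + z) ^+ d else 1.

Lemma wr_activity_gt0 l c : 0 < l -> 0 < wr_activity l c.
Proof. by case: c. Qed.

Lemma dec_weight_eq l x z : 0 < l -> 0 < x -> 0 < z ->
  x = tree_step (eff_activity m l) d x z -> z = tree_step (eff_activity m l) d z x ->
  forall v c, dec_scale l x z v * dec_weight l x z v c =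
    wr_activity l c * \prod_(u <- ch dec_tree v) msg (dec_weight l x z) u c.
Proof.
move=> l0 x0 z0 ex ez v c; rewrite /dec_scale {1}/dec_weight.
case: (boolP (m.+1 %| v)%N) => [/dvdnP[i ->]|nv]; last first.
  by rewrite /= /dec_ch (negPf nv) big_nil mul1r mulr1.
rewrite mulnC prod_dec_ch.
have hl j : (j < m)%N -> msg (dec_weight l x z) (m.+1 * i + j.+1)%N c =
    if c is Yellow then 1 + 2 * l else 1 + l.
  by move=> jm; rewrite /msg big_color /dec_weight leaf_ndvd //=; case: c => /=; ring.
have hi k : msg (dec_weight l x z) (m.+1 * (d * i + k.+1))%N c =
    match c with Green => 1 + x | Yellow => 1 + x + z | Red => 1 + z end.
  by rewrite /msg big_color /dec_weight dvdn_mulr //=; case: c {hl} => /=; ring.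
have -> : \prod_(j < m) msg (dec_weight l x z) (m.+1 * i + j.+1)%N c =
    (if c is Yellow then 1 + 2 * l else 1 + l) ^+ m.
  rewrite -[in RHS](card_ord m) -prodr_const; apply: eq_bigr => j _; exact: hl.
have -> : \prod_(k < d) msg (dec_weight l x z) (m.+1 * (d * i + k.+1))%N c =
    (match c with Green => 1 + x | Yellow => 1 + x + z | Red => 1 + z end) ^+ d.
  rewrite -[in RHS](card_ord d) -prodr_const; apply: eq_bigr => k _; exact: hi.
have l2 : (1 + 2 * l) ^+ m != 0 by rewrite expf_neq0 // gt_eqF //; lra.
have xz : (1 + x + z) ^+ d != 0 by rewrite expf_neq0 // gt_eqF //; lra.
case: c {hl hi}; rewrite /wr_activity ?mulr1 ?mul1r //.
  rewrite {2}ex /tree_step /eff_activity /leaf_factor !expr_div_n.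
  by field; rewrite l2 xz.
rewrite {2}ez /tree_step /eff_activity /leaf_factor !expr_div_n (addrAC 1 z x).
by field; rewrite l2 xz.
Qed.

Lemma dec_weight_gt0 l x z : 0 < l -> 0 < x -> 0 < z -> forall v c, 0 < dec_weight l x z v c.
Proof. by move=> l0 x0 z0 v c; rewrite /dec_weight; case: ifP => _; case: c. Qed.

Lemma dec_scale_neq0 l x z : 0 < l -> 0 < x -> 0 < z -> forall v, dec_scale l x z v != 0.
Proof.
move=> l0 x0 z0 v; rewrite /dec_scale; case: ifP => _; last exact: oner_neq0.
by rewrite mulf_neq0 // expf_neq0 // gt_eqF //; lra.
Qed.

Lemma dec_multiple l : (2 <= d)%N -> 0 < l -> critical_activity R d < eff_activity m l ->
  multiple_gibbs (tree_board dec_tree) (wr_activity l).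
Proof.
move=> d2 l0 Lc; have [x [z [z0 zx ex ez]]] := tree_fixpoint_asym d2 Lc.
have x0 : 0 < x by exact: lt_trans zx.
have mu0 c := wr_activity_gt0 c l0.
have [P1 [g1 c1]] := tree_gibbs_exists mu0 (dec_weight_gt0 l0 x0 z0) (dec_scale_neq0 l0 x0 z0)
  (dec_weight_eq l0 x0 z0 ex ez).
have [P2 [g2 c2]] := tree_gibbs_exists mu0 (dec_weight_gt0 l0 z0 x0) (dec_scale_neq0 l0 z0 x0)
  (dec_weight_eq l0 z0 x0 ez ex).
(* The two chains differ by exchanging green and red; the root is green with probability x / (1 + x
   + z) in one and z / (1 + x + z) in the other. *)
exists P1, P2; split=> //; exists (cell (fun v => (v < 1)%N) (fun=> Green)); split.
  exact: (@depends_on_measurable_lt 1 _ (@depends_on_cell _ _)).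
rewrite c1 c2 => -[]; rewrite /path_prob !big_ord_recr !big_ord0 /= !mul1r.
rewrite /ker /msg !big_color /dec_weight dvdn0 /= !mul1r => /eqP.
have -> : z + (1 + x) = x + (1 + z) by ring.
by rewrite -subr_eq0 -mulrBl mulf_eq0 invr_eq0 subr_eq0 !gt_eqF //; lra.
Qed.

(** * Convergence of the boundary weights to a symmetric fixed point *)

Section Subcritical.
Variables (l x : R).
Hypothesis l_gt0 : 0 < l.
Let L := eff_activity m l.
Let mu := @wr_activity R l.
Hypotheses (x_gt0 : 0 < x) (x_fix : x = tree_step L d x x).
Hypotheses (X_cvg : ((tree_iter L d k).1 @[k --> \oo] --> x)%classic)
  (Z_cvg : ((tree_iter L d k).2 @[k --> \oo] --> x)%classic).

Let mu_gt0 c : 0 < mu c := wr_activity_gt0 c l_gt0.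
Let L_gt0 : 0 < L := eff_activity_gt0 m l_gt0.

(** Cutting at a multiple of [m.+1] keeps the first [n] nodes together with all their leaves. *)
Let bw n psi := boundary_weight dec_tree mu (m.+1 * n) psi.
Let rel n psi v c := bw n psi v c / bw n psi v Yellow.

Lemma leaf_lt n i j : (i < n)%N -> (j < m)%N -> (m.+1 * i + j.+1 < m.+1 * n)%N.
Proof. by move=> ni jm; nia. Qed.

Lemma leaf_weight n psi v c : ~~ (m.+1 %| v)%N -> (v < m.+1 * n)%N -> bw n psi v c = mu c.
Proof.
move=> nv vn; rewrite /bw boundary_weight_in //= /dec_ch (negPf nv) big_nil mulr1 //.
Qed.

Lemma msg_ratio_bounds n psi v c :
  0 < msg (bw n psi) v Yellow /\ 0 <= msg (bw n psi) v c / msg (bw n psi) v Yellow <= 1.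
Proof.
have b0 c' : 0 <= bw n psi v c' by exact: boundary_rec_ge0.
have y0 : 0 < msg (bw n psi) v Yellow.
  case: (leqP (m.+1 * n) v) => nv; first by rewrite /bw msg_boundary_out.
  exact: msg_boundary_gt0.
split=> //; apply/andP; split.
  by rewrite divr_ge0 ?(ltW y0) // sumr_ge0 // => c' _; rewrite mulr_ge0.
rewrite ler_pdivrMr // mul1r; apply: ler_sum => c' _.
by rewrite ler_wpM2r // ler_nat; case: c; case: c'.
Qed.

Lemma rel_node n psi i c : (i < n)%N -> c != Yellow ->
  rel n psi (m.+1 * i)%N c =
  L * \prod_(k < d) (msg (bw n psi) (m.+1 * (d * i + k.+1))%N c /
                     msg (bw n psi) (m.+1 * (d * i + k.+1))%N Yellow).
Proof.
move=> ni cY; have iN : (m.+1 * i < m.+1 * n)%N by rewrite ltn_pmul2l.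
rewrite /rel /bw !boundary_weight_in // -/(bw n psi) !prod_dec_ch -/(bw n psi).
have hl j : (j < m)%N -> forall c, msg (bw n psi) (m.+1 * i + j.+1)%N c =
    if c is Yellow then 1 + 2 * l else 1 + l.
  move=> jm c'; rewrite /msg big_color !leaf_weight ?leaf_ndvd ?leaf_lt //.
  by case: c'; rewrite /mu /=; ring.
have pl c' : \prod_(j < m) msg (bw n psi) (m.+1 * i + j.+1)%N c' =
    (if c' is Yellow then 1 + 2 * l else 1 + l) ^+ m.
  by rewrite -[in RHS](card_ord m) -prodr_const; apply: eq_bigr => j _; exact: hl.
rewrite !pl prodf_div.
set p := \prod_(k < d) _; set q := \prod_(k < d) _.
have q0 : q != 0.
  by rewrite gt_eqF // prodr_gt0 // => k _; have [] := msg_ratio_bounds n psi (m.+1 * (d * i + k.+1)) Yellow.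
have l2 : (1 + 2 * l) ^+ m != 0 by rewrite expf_neq0 // gt_eqF //; have := l_gt0; lra.
rewrite /L /eff_activity /leaf_factor expr_div_n.
have -> : mu c = l by case: (neq_yellow cY) => ->.
have -> : (if c is Yellow then 1 + 2 * l else 1 + l) = 1 + l by case: (neq_yellow cY) => ->.
by rewrite /mu /=; field; rewrite l2 q0.
Qed.

(** A child j of node i satisfies j + 1 <= (d + 1) (i + 1), so the hypothesis keeps [k] generations
    below [i] inside the patch. Each generation applies the monotone recursion once to the
    bounds. *)
Lemma rel_node_bounds k n psi i c : (d.+1 ^ k * i.+1 <= n)%N -> c != Yellow ->
  (tree_iter L d k).2 <= rel n psi (m.+1 * i)%N c <= (tree_iter L d k).1.
Proof.
elim: k i c => [|k IH] i c ni cY.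
  rewrite rel_node ?mul1n //; last by rewrite expn0 mul1n in ni.
  set p := \prod_(k < d) _; have /andP[p0 p1] : 0 <= p <= 1.
    have h (k : 'I_d) : 0 <= msg (bw n psi) (m.+1 * (d * i + k.+1))%N c /
        msg (bw n psi) (m.+1 * (d * i + k.+1))%N Yellow <= 1.
      by have [] := msg_ratio_bounds n psi (m.+1 * (d * i + k.+1)) c.
    by apply/andP; split; [apply: prodr_ge0|apply: prodr_ile1] => k _; have /andP[] := h k.
  by rewrite /= mulr_ge0 ?(ltW L_gt0) // ler_piMr // ltW.
have [z0 _ _ _] := tree_iter_mono d L_gt0 k.
have ltin : (i < n)%N.
  by apply: leq_trans ni; rewrite leq_pmull // expn_gt0.
rewrite rel_node //=; set X := (tree_iter L d k).1; set Z := (tree_iter L d k).2.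
have hk (k' : 'I_d) : let u := (m.+1 * (d * i + k'.+1))%N in
    (1 + Z) / (1 + Z + X) <= msg (bw n psi) u c / msg (bw n psi) u Yellow <= (1 + X) / (1 + X + Z).
  move=> u; have kn : (d.+1 ^ k * (d * i + k'.+1).+1 <= n)%N.
    apply: leq_trans ni; rewrite expnSr -mulnA leq_mul2l; apply/orP; right.
    by have := ltn_ord k'; nia.
  have un : (u < m.+1 * n)%N.
    by rewrite /u ltn_pmul2l //; apply: leq_trans kn; rewrite leq_pmull // expn_gt0.
  have hG : Z <= rel n psi u Green <= X by apply: IH => //; apply/eqP.
  have hR : Z <= rel n psi u Red <= X by apply: IH => //; apply/eqP.
  have y0 := boundary_weight_yellow_gt0 dec_tree mu_gt0 psi un.
  have e : msg (bw n psi) u c / msg (bw n psi) u Yellow =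
      (1 + rel n psi u c) / (1 + rel n psi u c + rel n psi u (if c is Green then Red else Green)).
    have s0 : 0 < msg (bw n psi) u Yellow by have [] := msg_ratio_bounds n psi u Yellow.
    have b0 c' : 0 <= bw n psi u c' by exact: boundary_rec_ge0.
    have eq3 (g r : R) : 0 <= g -> 0 <= r -> let y := bw n psi u Yellow in
        (g + y) / (g + y + r) = (1 + g / y) / (1 + g / y + r / y).
      move=> g0 r0 y; have y1 : 0 < y := y0.
      have -> : 1 + g / y = (g + y) / y by field; rewrite gt_eqF.
      have -> : (g + y) / y + r / y = (g + y + r) / y by rewrite -mulrDl.
      by rewrite invf_div mulrA divfK // gt_eqF.
    case: (neq_yellow cY) => ->; rewrite /rel -eq3 //; rewrite /msg !big_color /=;
      congr (_ / _); ring.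
  rewrite e; apply: tree_ratio_mono => //; by case: (neq_yellow cY) => ->.
have Z1 : 0 <= (1 + Z) / (1 + Z + X).
  have : Z <= X by have /andP[h1 h2] := IH i c (leq_trans (leq_mul (leq_pexp2l (ltn0Sn d) (leqnSn k)) (leqnn _)) ni) cY; exact: le_trans h2.
  by move=> h; rewrite divr_ge0 //; lra.
apply/andP; split; rewrite /tree_step ler_pM2l //.
  rewrite -[in leLHS](card_ord d) -prodr_const; apply: ler_prod => k' _.
  by have /andP[h _] := hk k'; rewrite Z1 h.
rewrite -[in leRHS](card_ord d) -prodr_const; apply: ler_prod => k' _.
have /andP[h h'] := hk k'; rewrite h' andbT; exact: le_trans h.
Qed.

Lemma rel_cvg psi v c : (rel n psi v c @[n --> \oo] --> dec_weight l x x v c)%classic.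
Proof.
have [n0 hn0] : exists n0, (v < m.+1 * n0)%N.
  by exists v.+1; rewrite leq_pmull.
have vn n : (n0 <= n)%N -> (v < m.+1 * n)%N.
  by move=> nn; apply: leq_trans hn0 _; rewrite leq_mul2l nn orbT.
have y0 n : (n0 <= n)%N -> bw n psi v Yellow != 0.
  by move=> nn; rewrite gt_eqF // boundary_weight_yellow_gt0 // vn.
case: (eqVneq c Yellow) => [->|cY].
  have -> : dec_weight l x x v Yellow = 1 by rewrite /dec_weight; case: ifP.
  apply: cvg_near_cst; exists n0 => // n /= nn; by rewrite /rel divff // y0.
case: (boolP (m.+1 %| v)%N) => [/dvdnP[i vi]|nv]; last first.
  apply: cvg_near_cst; exists n0 => // n /= nn.
  by rewrite /rel !leaf_weight ?vn // /dec_weight (negPf nv) /mu /= divr1.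
have -> : dec_weight l x x v c = x by rewrite /dec_weight vi dvdn_mull //; case: (neq_yellow cY) => ->.
apply/cvgrPdist_le => e e0.
have /cvgrPdist_le/(_ e e0)[k1 _ h1] := X_cvg; have /cvgrPdist_le/(_ e e0)[k2 _ h2] := Z_cvg.
have := h1 (maxn k1 k2) (leq_maxl _ _); have := h2 (maxn k1 k2) (leq_maxr _ _).
set k := maxn k1 k2 => /=; rewrite !ler_norml => /andP[a1 a2] /andP[a3 a4].
exists (d.+1 ^ k * i.+1)%N => // n /= nn.
have := rel_node_bounds psi nn cY; rewrite vi mulnC => /andP[b1 b2].
by rewrite ler_norml; apply/andP; split; lra.
Qed.

(** Kernels do not change when the weights at a vertex are rescaled, so the weights relative to
    yellow, which converge, may be used. *)
Lemma dec_ker_cvg psi v c c' :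
  (ker (bw n psi) v c c' @[n --> \oo] --> ker (dec_weight l x x) v c c')%classic.
Proof.
suff h : (ker (rel n psi) v c c' @[n --> \oo] --> ker (dec_weight l x x) v c c')%classic.
  apply: cvg_trans h; apply: near_eq_cvg; exists v.+1 => // n /= vn.
  have vN : (v < m.+1 * n)%N by apply: leq_trans vn _; rewrite leq_pmull.
  have y0 : bw n psi v Yellow != 0 by rewrite gt_eqF // boundary_weight_yellow_gt0.
  have e : msg (rel n psi) v c = msg (bw n psi) v c / bw n psi v Yellow.
    by rewrite /msg mulr_suml; apply: eq_bigr => c1 _; rewrite mulrA.
  by rewrite /ker e invf_div /rel mulrA mulrA divfK.
rewrite /ker; apply: cvgM.
  by apply: cvgM; [exact: cvg_cst|exact: rel_cvg].
apply: cvgV; first by rewrite gt_eqF // (@msg_gt0 _ _ (dec_weight_gt0 l_gt0 x_gt0 x_gt0)).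
rewrite /msg big_color; under eq_fun do rewrite big_color.
by apply: cvgD; [|apply: cvgD]; (apply: cvgM; [exact: cvg_cst|exact: rel_cvg]).
Qed.

Lemma dec_unique_of_fixpoint : unique_gibbs (tree_board dec_tree) mu.
Proof.
apply: (tree_unique_gibbs mu_gt0 (dec_weight_gt0 l_gt0 x_gt0 x_gt0)
  (dec_scale_neq0 l_gt0 x_gt0 x_gt0) (dec_weight_eq l_gt0 x_gt0 x_gt0 x_fix x_fix)
  (Ns := fun n => (m.+1 * n)%N)).
  by move=> n; rewrite leq_pmull.
exact: dec_ker_cvg.
Qed.
End Subcritical.

Lemma dec_unique l : (2 <= d)%N -> 0 < l -> eff_activity m l <= critical_activity R d ->
  unique_gibbs (tree_board dec_tree) (wr_activity l).
Proof.
move=> d2 l0 Lc; have [x [x0 ex Xx Zx]] := tree_iter_cvg (eff_activity_gt0 m l0) d2 Lc.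
apply: (@dec_unique_of_fixpoint l x) => //.
Qed.
End DecoratedTree.

Theorem theorem7p1 (R : realType) :
  exists a b c : R, [/\ 0 < a, a < b & b < c] /\
  exists G : board,
    (forall lambda : R, 0 < lambda -> (lambda <= a \/ (b <= lambda /\ lambda <= c)) ->
       unique_gibbs G (wr_activity lambda)) /\
    (forall lambda : R, ((a < lambda /\ lambda < b) \/ c < lambda) ->
       multiple_gibbs G (wr_activity lambda)).
Proof.
have [a [b [c [[a0 ab bc] [below above]]]]] := eff_activity12_crossings (critical_activity160 R).
(* For [d] = 160 the critical activity lies in the range [1/160, 1/36] of levels that the effective
   activity with 12 leaves crosses three times. *)
exists a, b, c; split=> //; exists (tree_board (@dec_tree 160 12 isT)); split=> l.
  move=> l0 h; apply: dec_unique => //; apply: below => //.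
  by case: h => [la|[bl lc]]; [left|right; rewrite bl].
move=> h; apply: dec_multiple => //; first by case: h => [[al _]|cl]; lra.
by apply: above; case: h => [[-> ->]|cl]; [left|right].
Qed.
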